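(* Let $n,p\in\mathbb{N}$, let $f\in\mathscr{E}'(\mathbb{T})$, and let $I\subset\mathbb{T}$ be a closed interval such that $\mathop{\rm supp} f\subset\mathscr{R}_n(I)$ and there is no closed interval $I'\subsetneq I$ with $\mathop{\rm supp} f\subset\mathscr{R}_n(I')$. Assume $|I|<\frac{2\pi}{pn}$. Then the smallest closed interval $K\subset pI$ such that $\mathop{\rm supp} f^{\ast p}\subset\mathscr{R}_n(K)$ is $K=pI$.
   Context: $\mathbb{T}=\mathbb{R}/2\pi\mathbb{Z}$ and $\mathscr{E}'(\mathbb{T})$ is the space of distributions on $\mathbb{T}$. For $y\in\mathbb{T}$ the shift $S_y$ is defined by $(S_yf)(\omega)=f(\omega-y)$. $\mathbb{Z}_n=\mathbb{Z}\bmod n$ and $\mathscr{R}_n(I)=\bigcup_{k\in\mathbb{Z}_n}S_{\frac{2\pi k}{n}}I$. A closed interval of $\mathbb{T}$ is the image of $[a,b]\subset\mathbb{R}$ with $|I|=b-a$. $pI=I+\dots+I$ ($p$ summands), i.e. the interval with endpoints $p\inf I$ and $p\sup I$, and $f^{\ast p}=f\ast\dots\ast f$ ($p$ factors, convolution on $\mathbb{T}$). *)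

(* Defs.v *)
From Stdlib Require Import Reals ZArith Lra.
From Coquelicot Require Import Coquelicot.
Open Scope R_scope.

(** Points of T = R/2piZ are represented by real numbers; subsets of T by
    2pi-periodic predicates on R (all sets built below are periodic). *)

Definition test_fun (phi : R -> R) : Prop :=
  (forall (k : nat) (x : R), ex_derive (Derive_n phi k) x) /\
  (forall x, phi (x + 2 * PI) = phi x).

Definition is_real_distr (u : (R -> R) -> R) : Prop :=
  (forall phi psi, test_fun phi -> test_fun psi ->
     u (fun x => phi x + psi x) = u phi + u psi) /\
  (forall (c : R) phi, test_fun phi -> u (fun x => c * phi x) = c * u phi) /\
  (exists (C : R) (N : nat), 0 <= C /\
     forall phi (M : R), test_fun phi ->
       (forall (j : nat) x, (j <= N)%nat -> Rabs (Derive_n phi j x) <= M) ->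
       Rabs (u phi) <= C * M).

(** A (complex) distribution f in E'(T) is given by its real and imaginary
    parts (u, v): <f, phi> = u phi + i v phi for real test functions phi
    (extended C-linearly to complex test functions). *)
Definition distr : Type := ((R -> R) -> R) * ((R -> R) -> R).

Definition is_distr (f : distr) : Prop :=
  is_real_distr (fst f) /\ is_real_distr (snd f).

Definition supp (f : distr) : R -> Prop := fun x =>
  forall eps : R, 0 < eps ->
    exists phi : R -> R, test_fun phi /\
      (forall y, (forall m : Z, eps <= Rabs (y - x + 2 * PI * IZR m)) -> phi y = 0) /\
      (fst f phi <> 0 \/ snd f phi <> 0).

Definition rconv (u w : (R -> R) -> R) : (R -> R) -> R :=
  fun phi => u (fun x => w (fun y => phi (x + y))).

Definition conv (f g : distr) : distr :=
  (fun phi => rconv (fst f) (fst g) phi - rconv (snd f) (snd g) phi,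
   fun phi => rconv (fst f) (snd g) phi + rconv (snd f) (fst g) phi).

(** f^{*p} = f * ... * f (p factors), for p >= 1. *)
Definition conv_pow (f : distr) (p : nat) : distr :=
  Nat.iter (Nat.pred p) (conv f) f.

Definition arc (a b : R) : R -> Prop := fun x =>
  exists m : Z, a <= x + 2 * PI * IZR m <= b.

Definition shift (y : R) (A : R -> Prop) : R -> Prop := fun w => A (w - y).

Definition rot_union (n : nat) (A : R -> Prop) : R -> Prop := fun x =>
  exists k : nat, (k < n)%nat /\ shift (2 * PI * INR k / INR n) A x.

Definition subset (A B : R -> Prop) : Prop := forall x, A x -> B x.
Definition set_eq (A B : R -> Prop) : Prop := forall x, A x <-> B x.
Definition strict_subset (A B : R -> Prop) : Prop :=
  subset A B /\ exists x, B x /\ ~ A x.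

(* Main.v *)
Require Import Defs.
From Stdlib Require Import Reals ZArith Lra Lia Psatz FunctionalExtensionality Classical ClassicalEpsilon.
From Coquelicot Require Import Coquelicot.
Open Scope R_scope.

(** Smooth functions near [R_n(I)] may be pulled back along a smooth
    [2 PI / n]-periodic [lam] which is the identity near [I]. For a character
    [e^(i m x)], the number [F_j(s) = <f^{*j}, e^(i m x) e^(s lam_j(x))>], with
    [lam_j] the identity near [j I], satisfies [F_(j+1) = F_1 F_j], because the
    supports of [f] and [f^{*j}] only see points where [lam_(j+1)(x + y) = lam_1(x) + lam_j(y)].
    If [f^{*p}] is supported in rotations of an interval ending at [p c < p b], then
    [|F_1(s)|^p = |F_p(s)| <= C e^(s p (c + delta))] for all [s >= 1], so
    [|F_1(s)| <= C' e^(s (c + delta))]. Phragmen's argument (approximating a test function by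
    polynomials in [e^(s x)]) shows that a functional of finite order with this growth on
    exponentials vanishes on functions supported in [x > c + delta]. Fourier inversion over
    the [n] rotations removes the characters, so [f] is supported in rotations of an
    interval strictly shorter than [I], against minimality. The left end is the same with
    [lam] replaced by [- lam]. *)

(** * Smooth functions *)

(** On the circle convolution has zero divisors, so no support theorem of Titchmarsh type holds in
    general. The length condition rescues it: [p I] fits into one period [2 PI / n], and there the
    local coordinates of the summands add up to the coordinate of the sum. The characters are there
    because a push-forward along a [2 PI / n]-periodic coordinate lays the [n] rotated pieces of [f]
    on top of each other, where they may cancel; the weights [e^(i m x)] tell the pieces apart and,
    being multiplicative, do not disturb the factorisation. Only real [s] is used, so no complex
    analysis enters. Complex values are pairs of reals; real and imaginary parts are not
    multiplicative, but the squared modulus is. The loss [delta] is harmless because a test function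
    that vanishes near an interval vanishes a little beyond its end. *)

Definition smooth (f : R -> R) : Prop := forall k x, ex_derive (Derive_n f k) x.

Lemma is_derive_eq (f : R -> R) (x l l' : R) : is_derive f x l -> l = l' -> is_derive f x l'.
Proof. now intros H <-. Qed.

Lemma Derive_n_Derive f k : Derive_n (Derive f) k = Derive_n f (S k).
Proof.
  induction k as [|k IH]; [reflexivity|].
  simpl. rewrite IH. reflexivity.
Qed.

Lemma smooth_ex_derive f x : smooth f -> ex_derive f x.
Proof. intros H. exact (H 0%nat x). Qed.

Lemma smooth_continuous f x : smooth f -> continuous f x.
Proof. intros H. apply (ex_derive_continuous f x), smooth_ex_derive, H. Qed.

Lemma smooth_Derive f : smooth f -> smooth (Derive f).
Proof. intros H k x. rewrite Derive_n_Derive. apply (H (S k)). Qed.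

Lemma smooth_Derive_n f k : smooth f -> smooth (Derive_n f k).
Proof.
  intros H. induction k as [|k IH]; [exact H|]. apply (smooth_Derive _ IH).
Qed.

(** Replaces explicit formulas for higher derivatives of products, composites and quotients: it is
    enough to exhibit a class, closed under one differentiation, that contains the function. *)
Lemma smooth_coind (X : (R -> R) -> Prop) :
  (forall f, X f -> exists g, X g /\ forall x, is_derive f x (g x)) ->
  forall f, X f -> smooth f.
Proof.
  intros HX f Hf k.
  assert (X (Derive_n f k)) as Hk.
  { induction k as [|k IH]; [exact Hf|].
    destruct (HX _ IH) as [g [Hg Hd]].
    replace (Derive_n f (S k)) with g; [exact Hg|].
    apply functional_extensionality. intros x. symmetry. simpl.
    apply is_derive_unique, Hd. }
  intros x. destruct (HX _ Hk) as [g [_ Hd]]. exists (g x). apply Hd.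
Qed.

Lemma smooth_is_derive f g : (forall x, is_derive f x (g x)) -> smooth g -> smooth f.
Proof.
  intros Hd Hg. apply (smooth_coind (fun h => h = f \/ smooth h)); [|now left].
  intros h [->|Hh].
  - exists g. split; [now right|exact Hd].
  - exists (Derive h). split; [right; now apply smooth_Derive|].
    intros x. apply Derive_correct, smooth_ex_derive, Hh.
Qed.

Lemma smooth_const c : smooth (fun _ => c).
Proof.
  apply (smooth_coind (fun f => exists c, f = fun _ => c)); [|now exists c].
  intros f [d ->]. exists (fun _ => 0). split; [now exists 0|].
  intros x. apply (is_derive_const d x).
Qed.

Lemma smooth_id : smooth (fun x => x).
Proof.
  apply (smooth_is_derive _ (fun _ => 1)); [|apply smooth_const].
  intros x. apply (is_derive_id x).
Qed.

Lemma smooth_plus f g : smooth f -> smooth g -> smooth (fun x => f x + g x).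
Proof.
  intros Hf Hg.
  apply (smooth_coind (fun h => exists f g, smooth f /\ smooth g /\ h = fun x => f x + g x));
    [|now exists f, g].
  clear f g Hf Hg. intros h (f & g & Hf & Hg & ->).
  exists (fun x => Derive f x + Derive g x). split.
  - exists (Derive f), (Derive g). auto using smooth_Derive.
  - intros x. apply @is_derive_plus; apply Derive_correct, smooth_ex_derive; assumption.
Qed.

(** The product rule leads out of the products but not out of their sums, which makes this a class
    for [smooth_coind]. *)
Inductive sum_of_products : (R -> R) -> Prop :=
| sop_mult f g : smooth f -> smooth g -> sum_of_products (fun x => f x * g x)
| sop_plus f g : sum_of_products f -> sum_of_products g ->
    sum_of_products (fun x => f x + g x).

Lemma smooth_mult f g : smooth f -> smooth g -> smooth (fun x => f x * g x).
Proof.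
  intros Hf Hg. apply (smooth_coind sum_of_products); [|now constructor].
  intros h Hh. induction Hh as [h1 h2 H1 H2|h1 h2 _ [g1 [G1 D1]] _ [g2 [G2 D2]]].
  - exists (fun x => Derive h1 x * h2 x + h1 x * Derive h2 x). split.
    + apply sop_plus; constructor; auto using smooth_Derive.
    + intros x. apply (is_derive_mult h1 h2 x (Derive h1 x) (Derive h2 x));
        [| |apply Rmult_comm]; apply Derive_correct, smooth_ex_derive; assumption.
  - exists (fun x => g1 x + g2 x). split; [now apply sop_plus|].
    intros x. now apply @is_derive_plus.
Qed.

Lemma smooth_scal c f : smooth f -> smooth (fun x => c * f x).
Proof. intros Hf. apply smooth_mult; [apply smooth_const|exact Hf]. Qed.

Lemma smooth_opp f : smooth f -> smooth (fun x => - f x).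
Proof.
  intros Hf. replace (fun x => - f x) with (fun x => (-1) * f x).
  - now apply smooth_scal.
  - apply functional_extensionality; intros; ring.
Qed.

Lemma smooth_minus f g : smooth f -> smooth g -> smooth (fun x => f x - g x).
Proof. intros Hf Hg. unfold Rminus. apply smooth_plus; [|apply smooth_opp]; assumption. Qed.

(** The factor [h] absorbs the inner derivatives that the chain rule produces. *)
Inductive sum_of_composites : (R -> R) -> Prop :=
| soc_comp f g h : smooth f -> smooth g -> smooth h ->
    sum_of_composites (fun x => g (f x) * h x)
| soc_plus f g : sum_of_composites f -> sum_of_composites g ->
    sum_of_composites (fun x => f x + g x).

Lemma smooth_comp g f : smooth g -> smooth f -> smooth (fun x => g (f x)).
Proof.
  intros Hg Hf.
  replace (fun x => g (f x)) with (fun x => g (f x) * 1)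
    by (apply functional_extensionality; intros; ring).
  apply (smooth_coind sum_of_composites); [|apply (soc_comp f g (fun _ => 1)); auto using smooth_const].
  clear f g Hf Hg.
  intros k Hk. induction Hk as [f g h Hf Hg Hh|h1 h2 _ [g1 [G1 D1]] _ [g2 [G2 D2]]].
  - exists (fun x => Derive g (f x) * (Derive f x * h x) + g (f x) * Derive h x). split.
    + apply soc_plus; constructor; auto using smooth_Derive, smooth_mult.
    + intros x.
      assert (is_derive (fun x => g (f x)) x (Derive f x * Derive g (f x))) as D.
      { apply (is_derive_comp g f); apply Derive_correct, smooth_ex_derive; assumption. }
      assert (is_derive h x (Derive h x)) as D' by (apply Derive_correct, smooth_ex_derive, Hh).
      apply (is_derive_eq _ _ _ _ (is_derive_mult _ _ _ _ _ D D' Rmult_comm)).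
      unfold mult, plus; simpl. ring.
  - exists (fun x => g1 x + g2 x). split; [now apply soc_plus|].
    intros x. now apply @is_derive_plus.
Qed.

Lemma smooth_shift f a : smooth f -> smooth (fun x => f (a + x)).
Proof.
  intros Hf. apply (smooth_comp f); [exact Hf|].
  apply smooth_plus; [apply smooth_const|apply smooth_id].
Qed.

Lemma smooth_exp : smooth exp.
Proof.
  apply (smooth_coind (fun f => f = exp)); [|reflexivity].
  intros f ->. exists exp. split; [reflexivity|]. apply is_derive_exp.
Qed.

Lemma smooth_exp_scal s : smooth (fun x => exp (s * x)).
Proof. apply (smooth_comp exp); [apply smooth_exp|apply smooth_scal, smooth_id]. Qed.

Lemma smooth_sin_cos : smooth sin /\ smooth cos.
Proof.
  assert (forall f, (exists a b, f = fun x => a * sin x + b * cos x) -> smooth f) as H.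
  { apply smooth_coind. intros f (a & b & ->).
    exists (fun x => (-b) * sin x + a * cos x). split; [now exists (-b), a|].
    intros x. auto_derive; [trivial|ring]. }
  split; apply H; [exists 1, 0|exists 0, 1]; apply functional_extensionality; intros; ring.
Qed.

Lemma smooth_loc f :
  (forall x, exists g, smooth g /\ locally x (fun y => f y = g y)) -> smooth f.
Proof.
  intros H k x. destruct (H x) as [g [Hg Hl]].
  apply (ex_derive_ext_loc (Derive_n g k)); [|apply Hg].
  apply locally_locally in Hl. revert Hl. apply filter_imp. intros y Hy.
  apply Derive_n_ext_loc. revert Hy. apply filter_imp. intros; auto.
Qed.

Lemma smooth_glue f g c eps :
  0 < eps -> smooth f -> smooth g ->
  (forall x, Rabs (x - c) < eps -> f x = g x) ->
  smooth (fun x => if Rle_dec x c then f x else g x).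
Proof.
  intros He Hf Hg Hfg. apply smooth_loc. intros x.
  (* Up to [c + eps / 2] the function is locally [f], since just beyond [c] the two branches still
     agree. *)
  destruct (Rlt_dec x (c + eps / 2)) as [Hx|Hx].
  - exists f. split; [exact Hf|]. exists (mkposreal (eps / 2) ltac:(lra)). intros y Hy.
    unfold ball in Hy; simpl in Hy. unfold AbsRing_ball, abs, minus, plus, opp in Hy; simpl in Hy.
    destruct (Rle_dec y c) as [Hc|Hc]; [reflexivity|]. symmetry. apply Hfg.
    apply Rabs_def2 in Hy. apply Rabs_def1; lra.
  - exists g. split; [exact Hg|]. exists (mkposreal (eps / 2) ltac:(lra)). intros y Hy.
    unfold ball in Hy; simpl in Hy. unfold AbsRing_ball, abs, minus, plus, opp in Hy; simpl in Hy.
    destruct (Rle_dec y c) as [Hc|Hc]; [|reflexivity]. exfalso.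
    apply Rabs_def2 in Hy. lra.
Qed.

(** * Finite sums and inverses *)

Fixpoint rsum (F : nat -> R) (m : nat) : R :=
  match m with O => 0 | S k => rsum F k + F k end.

Lemma rsum_ext F G m : (forall i, (i < m)%nat -> F i = G i) -> rsum F m = rsum G m.
Proof.
  induction m as [|m IH]; intros H; [reflexivity|]. simpl.
  rewrite IH, (H m); [reflexivity|lia|]. intros; apply H; lia.
Qed.

Lemma rsum_sum_f_R0 F m : rsum F (S m) = sum_f_R0 F m.
Proof.
  induction m as [|m IH]; [simpl; ring|]. change (rsum F (S m) + F (S m) = sum_f_R0 F (S m)).
  rewrite IH. reflexivity.
Qed.

Lemma rsum_le F G m : (forall i, (i < m)%nat -> F i <= G i) -> rsum F m <= rsum G m.
Proof.
  induction m as [|m IH]; intros H; simpl; [lra|].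
  apply Rplus_le_compat; [apply IH; intros|]; apply H; lia.
Qed.

Lemma rsum_Rabs F m : Rabs (rsum F m) <= rsum (fun i => Rabs (F i)) m.
Proof.
  induction m as [|m IH]; simpl; [rewrite Rabs_R0; lra|].
  apply Rle_trans with (1 := Rabs_triang _ _). lra.
Qed.

Lemma rsum_scal c F m : rsum (fun i => c * F i) m = c * rsum F m.
Proof. induction m as [|m IH]; simpl; [ring|]. rewrite IH. ring. Qed.

Lemma rsum_const c m : rsum (fun _ => c) m = INR m * c.
Proof. induction m as [|m IH]; [simpl; ring|]. rewrite S_INR. simpl. rewrite IH. ring. Qed.

Lemma smooth_sum (F : nat -> R -> R) m :
  (forall i, smooth (F i)) -> smooth (fun x => rsum (fun i => F i x) m).
Proof.
  intros H. induction m as [|m IH]; simpl; [apply smooth_const|].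
  apply smooth_plus; [exact IH|apply H].
Qed.

(** The quotient rule keeps the shape [g / f^k] and only raises [k] by one, so these quotients form
    a class for [smooth_coind]. *)
Lemma smooth_inv f : smooth f -> (forall x, f x <> 0) -> smooth (fun x => / f x).
Proof.
  intros Hf Hn.
  apply (smooth_coind (fun h => exists k g, smooth g /\ h = fun x => g x * / f x ^ k)).
  - intros h (k & g & Hg & ->).
    exists (fun x => (Derive g x * f x - INR k * g x * Derive f x) * / f x ^ (S k)). split.
    + exists (S k). eexists. split; [|reflexivity].
      apply smooth_minus; [apply smooth_mult; [now apply smooth_Derive|exact Hf]|].
      apply smooth_mult; [now apply smooth_scal|now apply smooth_Derive].
    + intros x.
      assert (is_derive f x (Derive f x)) as D1 by (apply Derive_correct, smooth_ex_derive, Hf).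
      assert (is_derive g x (Derive g x)) as D2 by (apply Derive_correct, smooth_ex_derive, Hg).
      auto_derive.
      * repeat split; [now exists (Derive g x)|now exists (Derive f x)|now apply pow_nonzero].
      (* The derivative of the power contains the exponent [k - 1], so [k = 0] needs its own
         computation. *)
      * destruct k as [|k]; simpl pred.
        -- simpl. change (Derive (fun x0 => f x0) x) with (Derive f x).
           change (Derive (fun x0 => g x0) x) with (Derive g x). field. apply Hn.
        -- change (Derive (fun x0 => f x0) x) with (Derive f x).
           change (Derive (fun x0 => g x0) x) with (Derive g x).
           simpl pow. field. split; [now apply pow_nonzero|apply Hn].
  - exists 1%nat, (fun _ => 1). split; [apply smooth_const|].
    apply functional_extensionality. intros x. field. apply Hn.
Qed.

(** * Flat functions and smooth cutoffs *)

Lemma is_derive_0_of_square_bound (f : R -> R) (C : R) :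
  0 <= C -> (forall y, Rabs (f y) <= C * y ^ 2) -> is_derive f 0 0.
Proof.
  intros HC H. apply is_derive_Reals. intros eps Heps.
  (* The added 1 keeps the quotient meaningful when [C = 0]. *)
  assert (0 < eps / (C + 1)) as Hd by (apply Rdiv_lt_0_compat; lra).
  exists (mkposreal _ Hd). intros h Hh Hlt. simpl in Hlt.
  assert (f 0 = 0) as H0.
  { generalize (H 0). intros E. replace (C * 0 ^ 2) with 0 in E by ring.
    generalize (Rabs_pos (f 0)). intros. apply Rabs_eq_0. lra. }
  rewrite Rplus_0_l, H0, !Rminus_0_r. unfold Rdiv. rewrite Rabs_mult, Rabs_inv.
  assert (0 < Rabs h) as Hp by now apply Rabs_pos_lt.
  apply Rmult_lt_reg_r with (Rabs h); [exact Hp|].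
  rewrite Rmult_assoc, Rinv_l by lra. rewrite Rmult_1_r.
  apply Rle_lt_trans with (1 := H h).
  rewrite <- (pow2_abs h).
  apply Rmult_lt_compat_r with (r := C + 1) in Hlt; [|lra].
  replace (eps / (C + 1) * (C + 1)) with eps in Hlt by (field; lra). nra.
Qed.

Lemma exp_pow_INR x k : exp x ^ k = exp (INR k * x).
Proof.
  induction k as [|k IH]; [simpl; rewrite Rmult_0_l; now rewrite exp_0|].
  rewrite S_INR. simpl pow. rewrite IH, <- exp_plus. f_equal. ring.
Qed.

(** Raise [1 + t <= exp t], at [t = y / (m + 1)], to the power [m + 1]. *)
Lemma exp_ge_pow m y : 0 <= y -> y ^ S m <= INR (S m) ^ S m * exp y.
Proof.
  intros Hy. assert (0 < INR (S m)) as Hm by (apply lt_0_INR; lia).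
  replace (exp y) with (exp (y / INR (S m)) ^ S m).
  - rewrite <- Rpow_mult_distr. apply pow_incr. split; [exact Hy|].
    generalize (exp_ineq1_le (y / INR (S m))). intros H.
    apply Rmult_le_compat_l with (r := INR (S m)) in H; [|lra].
    replace (INR (S m) * (1 + y / INR (S m))) with (INR (S m) + y) in H by (field; lra). lra.
  - rewrite exp_pow_INR. f_equal. field. lra.
Qed.

(* [flat k x = x^-k exp (-1/x)] on the positive axis; the span of this family is
   closed under differentiation. *)
Definition flat (k : nat) (x : R) : R :=
  if Rle_dec x 0 then 0 else exp (- / x) * / x ^ k.

(** By [exp_ge_pow] at [1 / y], the exponential supplies [k + 2] powers of [y]; dividing by [y^k]
    leaves two, enough for a zero derivative at the origin. *)
Lemma flat_square_bound k y : Rabs (flat k y) <= INR (S (S k)) ^ S (S k) * y ^ 2.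
Proof.
  assert (0 <= INR (S (S k)) ^ S (S k)) as HC by (apply pow_le, pos_INR).
  unfold flat. destruct (Rle_dec y 0) as [H|H].
  - rewrite Rabs_R0. apply Rmult_le_pos; [exact HC|apply pow2_ge_0].
  - assert (0 < y) as Hy by lra.
    assert (0 < y ^ k) as Hk by now apply pow_lt.
    assert (0 < / y) as Hi by now apply Rinv_0_lt_compat.
    rewrite Rabs_right.
    2: { apply Rle_ge, Rmult_le_pos; [left; apply exp_pos|left; now apply Rinv_0_lt_compat]. }
    generalize (exp_ge_pow (S k) (/ y) ltac:(lra)). intros E.
    rewrite exp_Ropp. set (c := INR (S (S k)) ^ S (S k)) in *.
    assert (0 < exp (/ y)) as He by apply exp_pos.
    rewrite pow_inv in E. simpl in E.
    apply Rmult_le_reg_r with (exp (/ y)); [exact He|].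
    replace (/ exp (/ y) * / y ^ k * exp (/ y)) with (/ y ^ k) by (field; lra).
    apply Rmult_le_compat_l with (r := y ^ 2) in E; [|apply pow2_ge_0].
    replace (y ^ 2 * / (y * (y * y ^ k))) with (/ y ^ k) in E by (field; lra). lra.
Qed.

Lemma is_derive_flat k x :
  is_derive (flat k) x (flat (S (S k)) x - INR k * flat (S k) x).
Proof.
  destruct (Rtotal_order x 0) as [H|[->|H]].
  - replace (flat (S (S k)) x - INR k * flat (S k) x) with 0.
    2: { unfold flat. destruct (Rle_dec x 0); lra. }
    apply is_derive_ext_loc with (fun _ => 0).
    2: apply (is_derive_const 0 x).
    exists (mkposreal (- x) ltac:(lra)). intros y Hy.
    unfold ball in Hy; simpl in Hy. unfold AbsRing_ball, abs, minus, plus, opp in Hy; simpl in Hy.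
    apply Rabs_def2 in Hy. unfold flat. destruct (Rle_dec y 0); lra.
  - replace (flat (S (S k)) 0 - INR k * flat (S k) 0) with 0.
    2: { unfold flat. destruct (Rle_dec 0 0); lra. }
    apply is_derive_0_of_square_bound with (2 := flat_square_bound k).
    apply pow_le, pos_INR.
  - assert (is_derive (fun x => exp (- / x) * / x ^ k) x
              (flat (S (S k)) x - INR k * flat (S k) x)) as D.
    { assert (x ^ k <> 0) as Hk by (apply pow_nonzero; lra).
      unfold flat. destruct (Rle_dec x 0) as [Hx|Hx]; [lra|].
      auto_derive; [repeat split; [lra|exact Hk]|].
      destruct k as [|k]; [simpl; field; lra|].
      simpl pred. simpl pow in *. field. split; [|lra].
      intros E. apply Hk. rewrite E. ring. }
    apply is_derive_ext_loc with (2 := D).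
    exists (mkposreal x H). intros y Hy.
    unfold ball in Hy; simpl in Hy. unfold AbsRing_ball, abs, minus, plus, opp in Hy; simpl in Hy.
    apply Rabs_def2 in Hy. unfold flat. destruct (Rle_dec y 0); [lra|reflexivity].
Qed.

Inductive flat_span : (R -> R) -> Prop :=
| flat_span_flat k : flat_span (flat k)
| flat_span_comb c f g : flat_span f -> flat_span g -> flat_span (fun x => f x - c * g x).

Lemma smooth_flat k : smooth (flat k).
Proof.
  apply (smooth_coind flat_span); [|constructor].
  intros f Hf. induction Hf as [j|c f g _ [f' [Sf Df]] _ [g' [Sg Dg]]].
  - exists (fun x => flat (S (S j)) x - INR j * flat (S j) x). split.
    + apply flat_span_comb; constructor.
    + apply is_derive_flat.
  - exists (fun x => f' x - c * g' x). split; [now constructor|].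
    intros x. apply @is_derive_minus; [apply Df|]. apply is_derive_scal, Dg.
Qed.

Lemma flat_pos x : 0 < x -> 0 < flat 0 x.
Proof.
  intros H. unfold flat. destruct (Rle_dec x 0); [lra|]. simpl.
  rewrite Rinv_1, Rmult_1_r. apply exp_pos.
Qed.

Lemma flat_zero x : x <= 0 -> flat 0 x = 0.
Proof. intros H. unfold flat. now destruct (Rle_dec x 0). Qed.

Lemma flat_nonneg x : 0 <= flat 0 x.
Proof.
  destruct (Rle_dec x 0) as [H|H]; [rewrite flat_zero; lra|].
  left. apply flat_pos. lra.
Qed.

(** The quotient of [flat 0 (s - x)] by its sum with [flat 0 (x - r)]: as [r < s], the two terms
    never vanish together. *)
Lemma smooth_step r s : r < s -> exists S : R -> R,
  smooth S /\ (forall x, 0 <= S x <= 1) /\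
  (forall x, x <= r -> S x = 1) /\ (forall x, s <= x -> S x = 0).
Proof.
  intros Hrs.
  assert (forall x, 0 < flat 0 (s - x) + flat 0 (x - r)) as Hpos.
  { intros x. generalize (flat_nonneg (s - x)) (flat_nonneg (x - r)). intros.
    destruct (Rlt_dec x s) as [H1|H1].
    - generalize (flat_pos (s - x)). lra.
    - generalize (flat_pos (x - r)). lra. }
  exists (fun x => flat 0 (s - x) * / (flat 0 (s - x) + flat 0 (x - r))).
  assert (smooth (fun x => flat 0 (s - x))) as S1.
  { apply (smooth_comp (flat 0)); [apply smooth_flat|].
    apply smooth_minus; [apply smooth_const|apply smooth_id]. }
  assert (smooth (fun x => flat 0 (x - r))) as S2.
  { apply (smooth_comp (flat 0)); [apply smooth_flat|].
    apply smooth_minus; [apply smooth_id|apply smooth_const]. }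
  split; [|split; [|split]].
  - apply smooth_mult; [exact S1|].
    apply (smooth_inv (fun x => flat 0 (s - x) + flat 0 (x - r))); [now apply smooth_plus|].
    intros x. generalize (Hpos x). lra.
  - intros x. generalize (Hpos x) (flat_nonneg (s - x)) (flat_nonneg (x - r)). intros Hp H1 H2.
    split.
    + apply Rmult_le_pos; [exact H1|left; now apply Rinv_0_lt_compat].
    + apply Rmult_le_reg_r with (1 := Hp). rewrite Rmult_assoc, Rinv_l; lra.
  - intros x Hx. generalize (Hpos x). rewrite (flat_zero (x - r)) by lra. intros.
    field. lra.
  - intros x Hx. rewrite (flat_zero (s - x)) by lra. ring.
Qed.

(** * Functionals with exponential growth *)

Definition linear_on_smooth (mu : (R -> R) -> R) : Prop :=
  (forall f g, smooth f -> smooth g -> mu (fun x => f x + g x) = mu f + mu g) /\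
  (forall c f, smooth f -> mu (fun x => c * f x) = c * mu f).

(** Encodes finite order and support in [[A, B]] at once: the derivatives are measured on [[A, B]]
    only, so the growth of exponentials elsewhere is not seen. *)
Definition order_at_most (N : nat) (A B : R) (mu : (R -> R) -> R) : Prop :=
  exists C, 0 <= C /\ forall g M, smooth g ->
    (forall j x, (j <= N)%nat -> A <= x <= B -> Rabs (Derive_n g j x) <= M) ->
    Rabs (mu g) <= C * M.

Lemma linear_rsum mu (c : nat -> R) (F : nat -> R -> R) m :
  linear_on_smooth mu -> (forall i, smooth (F i)) ->
  mu (fun x => rsum (fun i => c i * F i x) m) = rsum (fun i => c i * mu (F i)) m.
Proof.
  intros [Hp Hs] HF. induction m as [|m IH]; simpl.
  - replace (fun _ : R => 0) with (fun x : R => 0 * 0) by (apply functional_extensionality; intros; ring).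
    rewrite (Hs 0 (fun _ => 0)); [ring|apply smooth_const].
  - rewrite (Hp (fun x => rsum (fun i => c i * F i x) m) (fun x => c m * F m x)).
    + rewrite IH, Hs by apply HF. reflexivity.
    + apply (smooth_sum (fun i x => c i * F i x)). intros; apply smooth_scal, HF.
    + apply smooth_scal, HF.
Qed.

Lemma smooth_bounded g A B : smooth g ->
  exists L, 0 <= L /\ forall x, A <= x <= B -> Rabs (g x) <= L.
Proof.
  intros Hg. destruct (Rle_dec A B) as [H|H].
  2: { exists 0. split; [lra|]. intros; lra. }
  destruct (continuity_ab_maj (fun x => Rabs (g x)) A B H) as [t [Ht _]].
  { intros c _. apply continuity_pt_filterlim.
    apply (continuous_comp g Rabs); [apply smooth_continuous, Hg|apply continuous_Rabs]. }
  exists (Rabs (g t)). split; [apply Rabs_pos|exact Ht].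
Qed.

Lemma smooth_lipschitz g A B : smooth g ->
  exists L, 0 <= L /\ forall x y, A <= x <= B -> A <= y <= B ->
    Rabs (g x - g y) <= L * Rabs (x - y).
Proof.
  intros Hg. destruct (smooth_bounded (Derive g) A B (smooth_Derive _ Hg)) as [L [HL H]].
  exists L. split; [exact HL|]. intros x y Hx Hy.
  destruct (MVT_gen g y x (Derive g)) as [c [Hc ->]].
  - intros; apply Derive_correct, smooth_ex_derive, Hg.
  - intros; apply continuity_pt_filterlim, smooth_continuous, Hg.
  - rewrite Rabs_mult. apply Rmult_le_compat_r; [apply Rabs_pos|]. apply H.
    revert Hc. unfold Rmin, Rmax. destruct (Rle_dec y x); lra.
Qed.

(* A polynomial in [exp (s t)] close to the indicator of [t > x]: with
   [z = exp (s (t - x)) <= M] one has [1 - z <= (1 - z/M)^M <= exp (-z)]. *)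
Definition soft_step (s : R) (M : nat) (x t : R) : R :=
  1 - (1 - exp (s * (t - x)) / INR (S M)) ^ S M.

(** The constant term cancels, so only the frequencies [(i + 1) s >= s] occur, and the growth
    hypothesis on exponentials covers all of them. *)
Lemma soft_step_expand s M x t :
  soft_step s M x t =
  rsum (fun i => - Binomial.C (S M) (S i) * (- / INR (S M)) ^ S i * exp (- (INR (S i) * s * x))
                 * exp (INR (S i) * s * t)) (S M).
Proof.
  unfold soft_step.
  replace (1 - exp (s * (t - x)) / INR (S M)) with (- / INR (S M) * exp (s * (t - x)) + 1)
    by (unfold Rdiv; ring).
  rewrite binomial, decomp_sum by lia. rewrite <- rsum_sum_f_R0.
  replace (Binomial.C (S M) 0 * (- / INR (S M) * exp (s * (t - x))) ^ 0 * 1 ^ (S M - 0)) with 1.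
  2: { unfold Binomial.C. rewrite Nat.sub_0_r, pow1. simpl fact at 2. simpl INR at 2.
       simpl pow. field. apply INR_fact_neq_0. }
  change (Init.Nat.pred (S M)) with M.
  match goal with |- 1 - (1 + ?a) = _ => replace (1 - (1 + a)) with ((-1) * a) by ring end.
  rewrite <- rsum_scal. apply rsum_ext. intros i Hi.
  rewrite pow1, Rpow_mult_distr, exp_pow_INR.
  replace (INR (S i) * (s * (t - x))) with (- (INR (S i) * s * x) + INR (S i) * s * t) by ring.
  rewrite exp_plus. ring.
Qed.

Lemma C_pos n i : (i <= n)%nat -> 0 <= Binomial.C n i.
Proof.
  intros H. unfold Binomial.C. apply Rmult_le_pos; [apply pos_INR|].
  left. apply Rinv_0_lt_compat, Rmult_lt_0_compat; apply INR_fact_lt_0.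
Qed.

(** Multiplying [1 - q <= exp (-q)] by [exp q] gives [exp q - 1 <= q exp q], and [exp q <= 3]. *)
Lemma exp_minus_1_le q : 0 <= q <= 1 -> exp q - 1 <= 3 * q.
Proof.
  intros Hq. generalize (exp_ineq1_le (- q)) (exp_pos q). rewrite exp_Ropp. intros H1 H2.
  assert (exp q <= 3) as H3.
  { apply Rle_trans with (exp 1); [|apply exp_le_3].
    destruct (Req_dec q 1) as [->|]; [lra|left; apply exp_increasing; lra]. }
  assert (exp q * (1 + - q) <= 1).
  { apply Rmult_le_compat_l with (r := exp q) in H1; [|lra].
    rewrite Rinv_r in H1 by lra. exact H1. }
  nra.
Qed.

Lemma exp_le x y : x <= y -> exp x <= exp y.
Proof. intros [H| ->]; [left; now apply exp_increasing|lra]. Qed.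

(** Absolute values of the alternating coefficients turn [1 - (1 - z/m)^m] into [(1 + q/m)^m - 1],
    with [m = S M] and [q = exp (s (c1 - x))]; this is at most [exp q - 1 <= 3 q]. The bound is
    uniform in [M], which can therefore be chosen last. *)
Lemma soft_step_apply_bound mu K c1 s M x :
  linear_on_smooth mu -> 0 <= K ->
  (forall s, 1 <= s -> Rabs (mu (fun t => exp (s * t))) <= K * exp (s * c1)) ->
  1 <= s -> c1 <= x ->
  Rabs (mu (soft_step s M x)) <= K * (3 * exp (s * (c1 - x))).
Proof.
  intros Hlin HK Hmu Hs Hx.
  set (q := exp (s * (c1 - x))).
  assert (0 <= q <= 1) as Hq.
  { split; [left; apply exp_pos|]. rewrite <- exp_0. apply exp_le. nra. }
  assert (0 < INR (S M)) as HM by (apply lt_0_INR; lia).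
  apply Rle_trans with (K * ((1 + q / INR (S M)) ^ S M - 1)).
  - replace (soft_step s M x) with (fun t => rsum (fun i => (- Binomial.C (S M) (S i) *
      (- / INR (S M)) ^ S i * exp (- (INR (S i) * s * x))) * exp (INR (S i) * s * t)) (S M))
      by (apply functional_extensionality; intros; now rewrite soft_step_expand).
    rewrite (linear_rsum mu _ (fun i t => exp (INR (S i) * s * t))); [|exact Hlin|].
    2: intros; apply smooth_exp_scal.
    apply Rle_trans with (1 := rsum_Rabs _ _).
    replace ((1 + q / INR (S M)) ^ S M - 1) with
      (rsum (fun i => Binomial.C (S M) (S i) * (q / INR (S M)) ^ S i) (S M)).
    + rewrite <- rsum_scal. apply rsum_le. intros i Hi.
      rewrite !Rabs_mult, Rabs_Ropp, (Rabs_right (Binomial.C _ _)) by (apply Rle_ge, C_pos; lia).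
      rewrite <- RPow_abs, Rabs_Ropp, (Rabs_right (/ _)) by (apply Rle_ge; left; now apply Rinv_0_lt_compat).
      rewrite (Rabs_right (exp _)) by (left; apply exp_pos).
      unfold Rdiv. rewrite Rpow_mult_distr. unfold q. rewrite exp_pow_INR.
      assert (Rabs (mu (fun t => exp (INR (S i) * s * t))) <= K * exp (INR (S i) * s * c1)) as Hb.
      { apply Hmu. rewrite S_INR. generalize (pos_INR i). nra. }
      replace (INR (S i) * (s * (c1 - x))) with (- (INR (S i) * s * x) + INR (S i) * s * c1) by ring.
      rewrite exp_plus.
      assert (0 <= Binomial.C (S M) (S i) * (/ INR (S M)) ^ S i * exp (- (INR (S i) * s * x))) as Hc.
      { apply Rmult_le_pos; [apply Rmult_le_pos; [apply C_pos; lia|]|left; apply exp_pos].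
        apply pow_le. left. now apply Rinv_0_lt_compat. }
      apply Rmult_le_compat_l with (1 := Hc) in Hb.
      eapply Rle_trans; [exact Hb|]. right. ring.
    + rewrite (Rplus_comm 1), binomial, decomp_sum by lia. rewrite <- rsum_sum_f_R0.
      replace (Binomial.C (S M) 0 * (q / INR (S M)) ^ 0 * 1 ^ (S M - 0)) with 1.
      2: { unfold Binomial.C. rewrite Nat.sub_0_r, pow1. simpl fact at 2. simpl INR at 2.
           simpl pow. field. apply INR_fact_neq_0. }
      change (Init.Nat.pred (S M)) with M.
      match goal with |- _ = 1 + ?a - 1 => replace (1 + a - 1) with a by ring end.
      apply rsum_ext. intros i Hi. rewrite pow1. ring.
  - apply Rmult_le_compat_l; [exact HK|].
    apply Rle_trans with (exp q - 1); [|now apply exp_minus_1_le].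
    apply Rplus_le_compat_r.
    replace (exp q) with (exp (q / INR (S M)) ^ S M)
      by (rewrite exp_pow_INR; f_equal; field; lra).
    apply pow_incr. split; [|apply exp_ineq1_le].
    assert (0 <= q / INR (S M)) by (apply Rdiv_le_0_compat; lra). lra.
Qed.

Lemma bernoulli_minus y k : 0 <= y <= 1 -> 1 - INR k * y <= (1 - y) ^ k.
Proof.
  intros Hy. induction k as [|k IH]; [simpl; lra|]. rewrite S_INR. simpl pow.
  generalize (pos_INR k). intros. apply Rmult_le_compat_l with (r := 1 - y) in IH; nra.
Qed.

Lemma soft_step_bounds s M x t (z := exp (s * (t - x))) : z <= INR (S M) ->
  0 <= soft_step s M x t <= 1 /\ soft_step s M x t <= z /\ 1 - soft_step s M x t <= exp (- z).
Proof.
  intros Hz. assert (0 < z) as Hz0 by apply exp_pos.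
  assert (0 < INR (S M)) as HM by (apply lt_0_INR; lia).
  assert (0 <= z / INR (S M) <= 1) as Hy.
  { split; [apply Rdiv_le_0_compat; lra|]. apply Rmult_le_reg_r with (1 := HM).
    replace (z / INR (S M) * INR (S M)) with z by (field; lra). lra. }
  unfold soft_step. fold z.
  assert (0 <= (1 - z / INR (S M)) ^ S M) as H0 by (apply pow_le; lra).
  assert ((1 - z / INR (S M)) ^ S M <= exp (- z)) as H1.
  { replace (exp (- z)) with (exp (- (z / INR (S M))) ^ S M)
      by (rewrite exp_pow_INR; f_equal; field; lra).
    apply pow_incr. generalize (exp_ineq1_le (- (z / INR (S M)))). lra. }
  assert ((1 - z / INR (S M)) ^ S M <= 1) as H2.
  { apply Rle_trans with (1 := H1). rewrite <- exp_0. apply exp_le. lra. }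
  generalize (bernoulli_minus _ (S M) Hy).
  replace (INR (S M) * (z / INR (S M))) with z by (field; lra). intros H3. lra.
Qed.

Lemma smooth_soft_step s M x : smooth (soft_step s M x).
Proof.
  replace (soft_step s M x) with (fun t => rsum (fun i => (- Binomial.C (S M) (S i) *
      (- / INR (S M)) ^ S i * exp (- (INR (S i) * s * x))) * exp (INR (S i) * s * t)) (S M))
      by (apply functional_extensionality; intros; now rewrite soft_step_expand).
  apply (smooth_sum (fun i t => _ * exp (INR (S i) * s * t))).
  intros i. apply smooth_scal, smooth_exp_scal.
Qed.

Definition heaviside (x t : R) : R := if Rle_dec x t then 1 else 0.

(** Truncation to [[-2, 1]]. The increment [clamp y - clamp (y - 1)] is nonnegative and equals 1 for
    [-1 < y < 1]; along a grid such increments telescope to at most 3. This counts the grid points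
    near [t] without a counting argument. *)
Definition clamp (y : R) : R := Rmax (-2) (Rmin y 1).

(** Outside the window [|t - x| < h] the error is at most [exp (- s h)], by one of the two estimates
    of [soft_step_bounds]; inside it is at most 1, which the increment of [clamp] pays for. *)
Lemma soft_step_heaviside s M h x t :
  0 < s -> 0 < h -> exp (s * (t - x)) <= INR (S M) ->
  Rabs (soft_step s M x t - heaviside x t) <=
  exp (- (s * h)) + (clamp ((t - x) / h) - clamp ((t - x) / h - 1)).
Proof.
  intros Hs Hh Hz. destruct (soft_step_bounds s M x t Hz) as [H1 [H2 H3]].
  set (w := soft_step s M x t) in *. set (z := exp (s * (t - x))) in *.
  assert (0 < exp (- (s * h))) as He by apply exp_pos.
  set (y := (t - x) / h).
  assert (t - x = y * h) as Ht by (unfold y; field; lra).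
  assert (0 <= clamp y - clamp (y - 1)) as Hc.
  { unfold clamp, Rmax, Rmin. repeat destruct Rle_dec; lra. }
  unfold heaviside. destruct (Rle_dec 1 y) as [Hy|Hy]; [|destruct (Rle_dec y (-1)) as [Hy'|Hy']].
  - destruct (Rle_dec x t) as [Hx|Hx]; [|nra].
    rewrite Rabs_minus_sym, Rabs_right by lra.
    assert (exp (- z) <= exp (- (s * h))); [|lra].
    apply exp_le. apply Ropp_le_contravar.
    apply Rle_trans with (s * (t - x)); [apply Rmult_le_compat_l; nra|].
    unfold z. generalize (exp_ineq1_le (s * (t - x))). lra.
  - destruct (Rle_dec x t) as [Hx|Hx]; [nra|].
    rewrite Rminus_0_r, Rabs_right by lra.
    assert (z <= exp (- (s * h))); [|lra].
    apply exp_le. assert (t - x <= - h) by nra. nra.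
  - assert (1 <= clamp y - clamp (y - 1)) as Hc'.
    { unfold clamp, Rmax, Rmin. repeat destruct Rle_dec; lra. }
    assert (Rabs (w - (if Rle_dec x t then 1 else 0)) <= 1); [|lra].
    destruct (Rle_dec x t); apply Rabs_le; lra.
Qed.

(** * Approximation of a Lipschitz function by soft steps on a grid *)

Section StepSum.
Variables (Th : R -> R) (L h c2 lo hi s t : R) (M : nat).
Hypotheses (HL : 0 <= L) (Hh : 0 < h) (Hs : 0 < s) (Hlo : lo <= c2) (Hlot : lo <= t).
Hypothesis HM : exp (s * (t - c2)) <= INR (S M).
Hypothesis Hvan : forall x, x <= c2 -> Th x = 0.
Hypothesis Hlip : forall x y, lo <= x <= hi -> lo <= y <= hi ->
  Rabs (Th x - Th y) <= L * Rabs (x - y).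

Let X (i : nat) := c2 + INR i * h.
Let D (i : nat) := Th (X (S i)) - Th (X i).

Let X_step i : X (S i) = X i + h.
Proof. unfold X. rewrite S_INR. ring. Qed.

Let X_ge i : c2 <= X i.
Proof. unfold X. generalize (pos_INR i). nra. Qed.

(** As long as the grid stays below [t], all steps are 1 and the jumps telescope to [Th (X m)]; once
    it has passed [t], further terms are 0 and the sum is frozen at a grid value within one mesh of
    [t]. *)
Lemma heaviside_sum_approx m : X m <= hi ->
  (X m <= t -> rsum (fun i => D i * heaviside (X i) t) m = Th (X m)) /\
  (t <= X m -> Rabs (Th t - rsum (fun i => D i * heaviside (X i) t) m) <= L * h).
Proof.
  induction m as [|m IH]; intros Hm.
  - assert (X 0 = c2) as E by (unfold X; simpl; ring). rewrite E. simpl. split; intros H.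
    + symmetry. apply Hvan. lra.
    + rewrite Hvan by lra. rewrite Rminus_0_r, Rabs_R0. nra.
  - assert (X m <= hi) as Hm' by (rewrite X_step in Hm; lra).
    destruct (IH Hm') as [IH1 IH2]. simpl rsum.
    generalize (X_ge m) (X_step m); intros G1 G2.
    unfold heaviside at 2 4. destruct (Rle_dec (X m) t) as [H|H].
    + rewrite IH1 by exact H. unfold D. split; intros H'; [ring|].
      replace (Th t - (Th (X m) + (Th (X (S m)) - Th (X m)) * 1)) with (Th t - Th (X (S m))) by ring.
      apply Rle_trans with (1 := Hlip t (X (S m)) ltac:(lra) ltac:(lra)).
      apply Rmult_le_compat_l; [exact HL|]. apply Rabs_le. lra.
    + split; intros H'; [lra|]. rewrite Rmult_0_r, Rplus_0_r. apply IH2. lra.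
Qed.

(** Every jump [D i] is at most [L h], and the increments of [clamp] telescope over the grid, so
    their total stays bounded however fine the grid is. *)
Lemma soft_heaviside_sum m : X m <= hi ->
  Rabs (rsum (fun i => D i * heaviside (X i) t) m - rsum (fun i => D i * soft_step s M (X i) t) m)
  <= L * h * (INR m * exp (- (s * h)) + (clamp ((t - X 0) / h) - clamp ((t - X m) / h))).
Proof.
  induction m as [|m IH]; intros Hm.
  - simpl. rewrite Rminus_0_r, Rabs_R0. right. ring.
  - generalize (X_ge m) (X_step m); intros G1 G2.
    specialize (IH ltac:(lra)). simpl rsum.
    match goal with |- Rabs (?a + ?b - (?c + ?d)) <= _ =>
      replace (a + b - (c + d)) with ((a - c) + (b - d)) by ring end.
    apply Rle_trans with (1 := Rabs_triang _ _).
    rewrite S_INR.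
    assert (Rabs (D m * heaviside (X m) t - D m * soft_step s M (X m) t) <=
      L * h * (exp (- (s * h)) + (clamp ((t - X m) / h) - clamp ((t - X (S m)) / h)))) as Hd.
    { rewrite <- Rmult_minus_distr_l, Rabs_mult, (Rabs_minus_sym (heaviside _ _)).
      apply Rmult_le_compat; try apply Rabs_pos.
      - unfold D. apply Rle_trans with (1 := Hlip (X (S m)) (X m) ltac:(lra) ltac:(lra)).
        apply Rmult_le_compat_l; [exact HL|]. apply Rabs_le. lra.
      - replace ((t - X (S m)) / h) with ((t - X m) / h - 1) by (rewrite G2; field; lra).
        apply soft_step_heaviside; [exact Hs|exact Hh|].
        apply Rle_trans with (2 := HM). apply exp_le. nra. }
    set (e := exp (- (s * h))) in *. nra.
Qed.

(** In the constant 4, one unit is the mesh error of the step function and three are the range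
    [1 - (-2)] of [clamp]. *)
Lemma soft_step_sum_approx m : hi = X m -> t <= hi ->
  Rabs (Th t - rsum (fun i => D i * soft_step s M (X i) t) m)
  <= L * h * (4 + INR m * exp (- (s * h))).
Proof.
  intros Hm Ht.
  destruct (heaviside_sum_approx m ltac:(lra)) as [_ H1]. specialize (H1 ltac:(lra)).
  generalize (soft_heaviside_sum m ltac:(lra)). intros H2.
  assert (clamp ((t - X 0) / h) - clamp ((t - X m) / h) <= 3) as Hc.
  { unfold clamp, Rmax, Rmin. repeat destruct Rle_dec; lra. }
  match goal with |- Rabs (?a - ?b) <= _ =>
    replace (a - b) with ((a - rsum (fun i => D i * heaviside (X i) t) m) +
      (rsum (fun i => D i * heaviside (X i) t) m - b)) by ring end.
  apply Rle_trans with (1 := Rabs_triang _ _).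
  assert (0 <= L * h) by nra. set (e := INR m * exp (- (s * h))) in *. nra.
Qed.
End StepSum.

Lemma exp_neg_small r eps : 0 < r -> 0 < eps -> exists S0, 1 <= S0 /\ exp (- (S0 * r)) <= eps.
Proof.
  intros Hr He. set (S0 := Rmax 1 (/ (eps * r))). exists S0.
  assert (0 < eps * r) as H by nra.
  assert (/ (eps * r) <= S0) as H1 by apply Rmax_r.
  split; [apply Rmax_l|]. rewrite exp_Ropp.
  generalize (exp_ineq1_le (S0 * r)). intros H2.
  assert (/ eps <= S0 * r) as H3.
  { apply Rmult_le_compat_r with (r := r) in H1; [|lra].
    replace (/ (eps * r) * r) with (/ eps) in H1 by (field; lra). exact H1. }
  assert (0 < / eps) by now apply Rinv_0_lt_compat.
  rewrite <- (Rinv_inv eps). apply Rinv_le_contravar; lra.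
Qed.

Lemma nat_above x : exists M, x <= INR (S M).
Proof.
  destruct (INR_unbounded x) as [M HM]. exists M. rewrite S_INR. lra.
Qed.

(* Phragmen's argument: replace [Th] by a step function and each step by a soft
   step, whose image under [mu] is controlled by the values on exponentials. *)
Lemma vanish_order_0 mu A B K c1 c2 Th :
  linear_on_smooth mu -> order_at_most 0 A B mu -> 0 <= K ->
  (forall s, 1 <= s -> Rabs (mu (fun t => exp (s * t))) <= K * exp (s * c1)) ->
  c1 < c2 -> smooth Th -> (forall x, x <= c2 -> Th x = 0) -> mu Th = 0.
Proof.
  intros Hlin [C [HC Hord]] HK Hmu Hc HTh Hvan.
  (* The length of the grid, kept at least 1 so that the mesh is positive even when [B <= c2]. *)
  set (W := Rmax 1 (B - c2)).
  assert (1 <= W) as HW by apply Rmax_l.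
  assert (B <= c2 + W) as HWB by (generalize (Rmax_r 1 (B - c2)); fold W; lra).
  set (lo := Rmin A c2).
  assert (lo <= A /\ lo <= c2) as [HloA Hlo2] by (split; [apply Rmin_l|apply Rmin_r]).
  destruct (smooth_lipschitz Th lo (c2 + W) HTh) as [L [HL Hlip]].
  apply Rabs_eq_0, Rle_antisym; [|apply Rabs_pos].
  apply Rnot_lt_le. intros Hpos. set (eps := Rabs (mu Th)) in *.
  (* The choices are nested: [m] fixes the mesh [h], then [s] is taken large for this [h], and [M]
     large for this [s]. *)
  destruct (nat_above (4 * (4 * C * L * W + 1) / eps)) as [m' Hm'].
  set (m := S m') in *.
  assert (0 < INR m) as Hm0 by (apply lt_0_INR; lia).
  set (h := W / INR m).
  assert (0 < h) as Hh by (apply Rdiv_lt_0_compat; lra).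
  assert (INR m * h = W) as HmW by (unfold h; field; lra).
  assert (4 * C * L * h <= eps / 4) as Hh1.
  { apply Rmult_le_reg_r with (INR m); [exact Hm0|].
    replace (4 * C * L * h * INR m) with (4 * C * L * W) by (rewrite <- HmW; ring).
    apply Rmult_le_compat_r with (r := eps / 4) in Hm'; [|lra].
    replace (4 * (4 * C * L * W + 1) / eps * (eps / 4)) with (4 * C * L * W + 1) in Hm' by (field; lra).
    lra. }
  (* One rate for both small terms: [exp (- s h)] from the soft steps, and [exp (s (c1 - x))] with
     [x >= c2] from [mu]. *)
  set (r := Rmin h (c2 - c1)).
  assert (0 < r) as Hr by (apply Rmin_pos; lra).
  assert (0 <= C * L * W + L * W * K * 3) as Hq.
  { assert (0 <= L * W) by nra. assert (0 <= L * W * K) by nra. 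
    assert (0 <= C * (L * W)) by nra. nra. }
  destruct (exp_neg_small r (eps / (4 * (C * L * W + L * W * K * 3 + 1))) Hr) as [s [Hs Hsmall]].
  { apply Rdiv_lt_0_compat; lra. }
  destruct (nat_above (exp (s * (B - c2)))) as [M HM].
  set (X := fun i : nat => c2 + INR i * h).
  set (D := fun i : nat => Th (X (S i)) - Th (X i)).
  set (Ap := fun t => rsum (fun i => D i * soft_step s M (X i) t) m).
  set (e := exp (- (s * r))) in *.
  assert (0 < e) as He by apply exp_pos.
  assert (smooth Ap) as HAp.
  { apply (smooth_sum (fun i t => D i * soft_step s M (X i) t)).
    intros i. apply smooth_scal, smooth_soft_step. }
  assert (Rabs (mu (fun t => Th t + (-1) * Ap t)) <= C * (L * h * (4 + INR m * e))) as E1.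
  { apply Hord.
    - apply smooth_plus; [exact HTh|now apply smooth_scal].
    - intros j t Hj Ht. replace j with 0%nat by lia. simpl Derive_n.
      replace (Th t + -1 * Ap t) with (Th t - Ap t) by ring.
      apply Rle_trans with (L * h * (4 + INR m * exp (- (s * h)))).
      + unfold Ap, D, X.
        apply (soft_step_sum_approx Th L h c2 lo (c2 + W)); try lra; auto.
        apply Rle_trans with (2 := HM). apply exp_le. nra.
      + apply Rmult_le_compat_l; [nra|]. apply Rplus_le_compat_l, Rmult_le_compat_l; [lra|].
        apply exp_le. generalize (Rmin_l h (c2 - c1)). fold r. nra. }
  assert (Rabs (mu Ap) <= L * W * (K * (3 * e))) as E2.
  { unfold Ap. rewrite (linear_rsum mu D (fun i t => soft_step s M (X i) t)); [|exact Hlin|].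
    2: intros; apply smooth_soft_step.
    apply Rle_trans with (1 := rsum_Rabs _ _).
    apply Rle_trans with (rsum (fun _ => L * h * (K * (3 * e))) m).
    - apply rsum_le. intros i Hi. rewrite Rabs_mult.
      assert (0 <= INR i) by apply pos_INR.
      assert (INR (S i) <= INR m) as Him by (apply le_INR; lia).
      assert (c2 <= X i) as HXi by (unfold X; nra).
      assert (X (S i) = X i + h) as HXS by (unfold X; rewrite S_INR; ring).
      assert (X (S i) <= c2 + W) by (unfold X; nra).
      apply Rmult_le_compat; try apply Rabs_pos.
      + unfold D. apply Rle_trans with (1 := Hlip (X (S i)) (X i) ltac:(lra) ltac:(lra)).
        apply Rmult_le_compat_l; [exact HL|]. apply Rabs_le. lra.
      + apply Rle_trans with (1 := soft_step_apply_bound mu K c1 s M (X i) Hlin HK Hmu Hs ltac:(lra)).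
        apply Rmult_le_compat_l; [exact HK|]. apply Rmult_le_compat_l; [lra|].
        apply exp_le. generalize (Rmin_r h (c2 - c1)). fold r. nra.
    - rewrite rsum_const. rewrite <- HmW. right. ring. }
  (* The right-hand side regroups into two terms of size at most [eps / 4], against [eps > 0]. *)
  assert (eps <= C * (L * h * (4 + INR m * e)) + L * W * (K * (3 * e))) as E3.
  { destruct Hlin as [Hp Hsc]. rewrite Hp, Hsc in E1; auto using smooth_scal.
    unfold eps. replace (mu Th) with ((mu Th + -1 * mu Ap) + mu Ap) by ring.
    apply Rle_trans with (1 := Rabs_triang _ _). lra. }
  assert (e * (C * L * W + L * W * K * 3) <= eps / 4) as E4.
  { apply Rle_trans with (e * (C * L * W + L * W * K * 3 + 1)); [nra|].
    apply Rmult_le_compat_r with (r := C * L * W + L * W * K * 3 + 1) in Hsmall; [|lra].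
    apply Rle_trans with (1 := Hsmall). right. field. lra. }
  replace (C * (L * h * (4 + INR m * e)) + L * W * (K * (3 * e))) with
    (4 * C * L * h + e * (C * L * (INR m * h) + L * W * K * 3)) in E3 by ring.
  rewrite HmW in E3. lra.
Qed.

(** * Lowering the order by integration *)

Definition primitive (A : R) (g : R -> R) (x : R) : R := RInt g A x.

Lemma is_derive_primitive A g x : smooth g -> is_derive (primitive A g) x (g x).
Proof.
  intros Hg. apply (is_derive_RInt g (primitive A g) A x).
  - apply filter_forall. intros y. apply (RInt_correct g A y), ex_RInt_continuous.
    intros z _. apply smooth_continuous, Hg.
  - apply smooth_continuous, Hg.
Qed.

Lemma smooth_primitive A g : smooth g -> smooth (primitive A g).
Proof.
  intros Hg. apply (smooth_is_derive _ g); [|exact Hg]. intros; now apply is_derive_primitive.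
Qed.

Lemma primitive_unique A F g : smooth g -> (forall x, is_derive F x (g x)) ->
  primitive A g = fun x => F x - F A.
Proof.
  intros Hg HF. apply functional_extensionality. intros x.
  apply is_RInt_unique. apply (is_RInt_derive F g); intros.
  - apply HF.
  - apply smooth_continuous, Hg.
Qed.

Lemma primitive_bound A B g M x : smooth g -> A <= x <= B ->
  (forall y, A <= y <= B -> Rabs (g y) <= M) -> Rabs (primitive A g x) <= (B - A) * M.
Proof.
  intros Hg Hx HM.
  assert (0 <= M) by (generalize (HM A ltac:(lra)) (Rabs_pos (g A)); lra).
  apply Rle_trans with ((x - A) * M); [|nra].
  apply (abs_RInt_le_const g A x M); [lra| |intros; apply HM; lra].
  apply (ex_RInt_continuous g A x). intros z _. apply smooth_continuous, Hg.
Qed.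

Lemma Derive_n_primitive A g j : smooth g -> Derive_n (primitive A g) (S j) = Derive_n g j.
Proof.
  intros Hg. rewrite <- Derive_n_Derive. f_equal. apply functional_extensionality.
  intros x. apply is_derive_unique. now apply is_derive_primitive.
Qed.

Lemma order_at_most_widen N A B A' B' mu :
  A' <= A -> B <= B' -> order_at_most N A B mu -> order_at_most N A' B' mu.
Proof.
  intros HA HB [C [HC H]]. exists C. split; [exact HC|]. intros g M Hg HM. apply H; [exact Hg|].
  intros; apply HM; [assumption|lra].
Qed.

(* Testing [mu] on primitives lowers its order by one and keeps the growth bound. *)
Theorem vanish_of_exp_growth N mu A B K c1 c2 Th :
  linear_on_smooth mu -> order_at_most N A B mu ->
  (forall s, 1 <= s -> Rabs (mu (fun t => exp (s * t))) <= K * exp (s * c1)) ->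
  c1 < c2 -> smooth Th -> (forall x, x <= c2 -> Th x = 0) -> mu Th = 0.
Proof.
  intros Hlin Hord Hmu Hc. revert c2 Hc Th.
  assert (0 <= K) as HK.
  { generalize (Hmu 1 ltac:(lra)) (Rabs_pos (mu (fun t => exp (1 * t)))) (exp_pos (1 * c1)).
    intros. apply Rnot_lt_le. intros HK. nra. }
  (* A left end at most [c1] makes [Th] vanish there and bounds the integration constant [exp (s A)]
     by [exp (s c1)]; the right end is raised so that the interval is nonempty. *)
  apply (order_at_most_widen N A B (Rmin A c1) (Rmax B (Rmin A c1))) in Hord;
    [|apply Rmin_l|apply Rmax_l].
  assert (Rmin A c1 <= c1) as HA by apply Rmin_r.
  assert (Rmin A c1 <= Rmax B (Rmin A c1)) as HAB by apply Rmax_r.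
  revert HA HAB Hord. generalize (Rmin A c1) (Rmax B (Rmin A c1)). clear A B.
  intros A B HA HAB Hord. revert mu K HK Hlin Hord Hmu.
  induction N as [|N IH]; intros mu K HK Hlin Hord Hmu c2 Hc Th HTh Hvan.
  { now apply (vanish_order_0 mu A B K c1 c2). }
  assert (Th = primitive A (Derive Th)) as ETh.
  { rewrite (primitive_unique A Th (Derive Th)).
    - apply functional_extensionality. intros x. rewrite (Hvan A) by lra. ring.
    - now apply smooth_Derive.
    - intros; apply Derive_correct, smooth_ex_derive, HTh. }
  rewrite ETh.
  (* The primitive of [exp (s t)] is [(exp (s t) - exp (s A)) / s], whence the new constant. The
     midpoint leaves room: [Derive Th] is read off where [Th] is zero on a neighbourhood. *)
  apply (IH (fun g => mu (primitive A g)) (K + Rabs (mu (fun _ => 1)))) with (c2 := (c1 + c2) / 2).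
  - generalize (Rabs_pos (mu (fun _ => 1))). lra.
  - destruct Hlin as [Hp Hs]. split.
    + intros f g Hf Hg.
      rewrite (primitive_unique A (fun x => primitive A f x + primitive A g x)).
      * rewrite <- Hp by now apply smooth_primitive. f_equal.
        apply functional_extensionality. intros x. unfold primitive.
        rewrite !RInt_point. unfold zero; simpl. ring.
      * now apply smooth_plus.
      * intros x. apply @is_derive_plus; now apply is_derive_primitive.
    + intros c f Hf. rewrite (primitive_unique A (fun x => c * primitive A f x)).
      * rewrite <- Hs by now apply smooth_primitive. f_equal.
        apply functional_extensionality. intros x. unfold primitive.
        rewrite !RInt_point. unfold zero; simpl. ring.
      * now apply smooth_scal.
      * intros x. apply is_derive_scal. now apply is_derive_primitive.
  - destruct Hord as [C [HC Hord]]. exists (C * (1 + (B - A))). split; [apply Rmult_le_pos; lra|].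
    intros g M Hg HM. rewrite Rmult_assoc. apply Hord; [now apply smooth_primitive|].
    assert (0 <= M).
    { generalize (HM 0%nat A ltac:(lia) ltac:(lra)) (Rabs_pos (Derive_n g 0 A)). lra. }
    intros [|j] x Hj Hx.
    + apply Rle_trans with ((B - A) * M); [|nra].
      apply (primitive_bound A B g M x Hg Hx). intros y Hy. apply (HM 0%nat y); [lia|exact Hy].
    + rewrite Derive_n_primitive by exact Hg.
      apply Rle_trans with (1 := HM j x ltac:(lia) Hx). nra.
  - intros s Hs. destruct Hlin as [Hp Hsc].
    replace (primitive A (fun t => exp (s * t))) with
      (fun t => / s * exp (s * t) + (- / s * exp (s * A)) * 1).
    + rewrite (Hp (fun t => / s * exp (s * t)) (fun t => (- / s * exp (s * A)) * 1)).
      2: apply smooth_scal, smooth_exp_scal.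
      2: apply (smooth_scal (- / s * exp (s * A)) (fun _ => 1)), smooth_const.
      rewrite (Hsc (/ s)) by apply smooth_exp_scal.
      rewrite (Hsc (- / s * exp (s * A)) (fun _ => 1)) by apply smooth_const.
      apply Rle_trans with (1 := Rabs_triang _ _).
      assert (0 < / s <= 1) as Hi.
      { split; [apply Rinv_0_lt_compat; lra|]. rewrite <- Rinv_1. apply Rinv_le_contravar; lra. }
      assert (0 < exp (s * A) <= exp (s * c1)) as HeA.
      { split; [apply exp_pos|apply exp_le; nra]. }
      rewrite !Rabs_mult, Rabs_Ropp, (Rabs_right (/ s)), (Rabs_right (exp _)) by lra.
      generalize (Hmu s Hs) (Rabs_pos (mu (fun t => exp (s * t)))) (Rabs_pos (mu (fun _ => 1))).
      intros G1 G2 G3. rewrite Rmult_plus_distr_r. apply Rplus_le_compat; [nra|].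
      rewrite Rmult_comm. apply Rmult_le_compat_l; [exact G3|]. nra.
    + rewrite (primitive_unique A (fun t => / s * exp (s * t))).
      * apply functional_extensionality. intros; ring.
      * apply smooth_exp_scal.
      * intros x. auto_derive; [trivial|]. field. lra.
  - lra.
  - now apply smooth_Derive.
  - intros x Hx. rewrite <- (Derive_const 0 x). apply Derive_ext_loc.
    exists (mkposreal (c2 - x) ltac:(lra)). intros y Hy.
    unfold ball in Hy; simpl in Hy. unfold AbsRing_ball, abs, minus, plus, opp in Hy; simpl in Hy.
    apply Rabs_def2 in Hy. apply Hvan. lra.
Qed.

(** * Distributions and convolution *)

Lemma periodic_IZR (f : R -> R) P k x : (forall x, f (x + P) = f x) -> f (x + P * IZR k) = f x.
Proof.
  intros H.
  assert (forall (m : nat) x, f (x + P * INR m) = f x) as Hn.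
  { intros m. induction m as [|m IH]; intros y.
    - simpl. f_equal. ring.
    - rewrite S_INR. replace (y + P * (INR m + 1)) with (y + P * INR m + P) by ring. now rewrite H. }
  destruct (Z_le_gt_dec 0 k) as [Hk|Hk].
  - rewrite <- (Z2Nat.id k), <- INR_IZR_INZ by lia. apply Hn.
  - replace x with (x + P * IZR k + P * INR (Z.to_nat (- k))) at 2; [now rewrite Hn|].
    rewrite INR_IZR_INZ, Z2Nat.id, opp_IZR by lia. ring.
Qed.

Lemma reduce_mod P a x : 0 < P -> exists k : Z, a <= x + P * IZR k < a + P.
Proof.
  intros HP. destruct (archimed ((x - a) / P)) as [H1 H2].
  assert ((x - a) / P * P = x - a) as E by (field; lra).
  exists (1 - up ((x - a) / P))%Z. rewrite minus_IZR.
  revert H1 H2 E. generalize (IZR (up ((x - a) / P))) ((x - a) / P).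
  intros k q H1 H2 E. split; nra.
Qed.

Lemma test_fun_smooth f : test_fun f -> smooth f.
Proof. intros [H _]. exact H. Qed.

Lemma test_fun_const c : test_fun (fun _ => c).
Proof. split; [apply smooth_const|reflexivity]. Qed.

Lemma test_fun_plus f g : test_fun f -> test_fun g -> test_fun (fun x => f x + g x).
Proof. intros [Hf Pf] [Hg Pg]. split; [now apply smooth_plus|]. intros; now rewrite Pf, Pg. Qed.

Lemma test_fun_mult f g : test_fun f -> test_fun g -> test_fun (fun x => f x * g x).
Proof. intros [Hf Pf] [Hg Pg]. split; [now apply smooth_mult|]. intros; now rewrite Pf, Pg. Qed.

Lemma test_fun_scal c f : test_fun f -> test_fun (fun x => c * f x).
Proof. intros Hf. apply test_fun_mult; [apply test_fun_const|exact Hf]. Qed.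

Lemma test_fun_shift f a : test_fun f -> test_fun (fun x => f (a + x)).
Proof.
  intros [Hf Pf]. split; [now apply smooth_shift|]. intros x. now rewrite <- Rplus_assoc, Pf.
Qed.

Lemma test_fun_comp g f : smooth g -> test_fun f -> test_fun (fun x => g (f x)).
Proof. intros Hg [Hf Pf]. split; [now apply smooth_comp|]. intros; now rewrite Pf. Qed.

Lemma Derive_n_shift f a j : Derive_n (fun y => f (a + y)) j = fun y => Derive_n f j (a + y).
Proof.
  induction j as [|j IH]; [reflexivity|]. simpl. rewrite IH. apply functional_extensionality.
  intros y. unfold Derive. f_equal. apply Lim_ext. intros h. simpl. now rewrite Rplus_assoc.
Qed.

Lemma Derive_n_lin f g a b j : smooth f -> smooth g ->
  Derive_n (fun y => a * f y + b * g y) j = fun y => a * Derive_n f j y + b * Derive_n g j y.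
Proof.
  intros Hf Hg. induction j as [|j IH]; [reflexivity|]. simpl. rewrite IH.
  apply functional_extensionality. intros y. apply is_derive_unique.
  apply @is_derive_plus; apply is_derive_scal, Derive_correct; [apply Hf|apply Hg].
Qed.

Lemma test_fun_Derive_n f j : test_fun f -> test_fun (Derive_n f j).
Proof.
  intros [Hf Pf]. split; [now apply smooth_Derive_n|].
  intros x. rewrite (Rplus_comm x).
  change (Derive_n f j (2 * PI + x)) with ((fun y => Derive_n f j (2 * PI + y)) x).
  rewrite <- Derive_n_shift. f_equal. apply functional_extensionality.
  intros y. rewrite Rplus_comm. apply Pf.
Qed.

Lemma test_fun_Derive f : test_fun f -> test_fun (Derive f).
Proof. apply (test_fun_Derive_n f 1). Qed.

Lemma test_fun_bounded f : test_fun f -> exists L, 0 <= L /\ forall x, Rabs (f x) <= L.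
Proof.
  intros [Hf Pf]. destruct (smooth_bounded f 0 (2 * PI) Hf) as [L [HL H]].
  exists L. split; [exact HL|]. intros x.
  destruct (reduce_mod (2 * PI) 0 x) as [k Hk]; [generalize PI_RGT_0; lra|].
  rewrite <- (periodic_IZR f (2 * PI) k x Pf). apply H. lra.
Qed.

Lemma test_fun_bounded_n f N : test_fun f ->
  exists L, 0 <= L /\ forall j x, (j <= N)%nat -> Rabs (Derive_n f j x) <= L.
Proof.
  intros Hf. induction N as [|N [L [HL H]]].
  - destruct (test_fun_bounded f Hf) as [L [HL H]]. exists L. split; [exact HL|].
    intros j x Hj. replace j with 0%nat by lia. apply H.
  - destruct (test_fun_bounded _ (test_fun_Derive_n f (S N) Hf)) as [L' [HL' H']].
    exists (L + L'). split; [lra|]. intros j x Hj.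
    destruct (Nat.eq_dec j (S N)) as [->|Hne].
    + generalize (H' x). lra.
    + generalize (H j x ltac:(lia)). lra.
Qed.

Lemma mean_value f x y L : smooth f -> (forall z, Rabs (Derive f z) <= L) ->
  Rabs (f x - f y) <= L * Rabs (x - y).
Proof.
  intros Hf HL. destruct (MVT_gen f y x (Derive f)) as [c [_ ->]].
  - intros; apply Derive_correct, smooth_ex_derive, Hf.
  - intros; apply continuity_pt_filterlim, smooth_continuous, Hf.
  - rewrite Rabs_mult. apply Rmult_le_compat_r; [apply Rabs_pos|apply HL].
Qed.

Lemma difference_quotient_bound f z h L : smooth f -> (forall z, Rabs (Derive (Derive f) z) <= L) ->
  h <> 0 -> Rabs (/ h * (f (z + h) - f z) - Derive f z) <= L * Rabs h.
Proof.
  intros Hf HL Hh.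
  destruct (MVT_gen f z (z + h) (Derive f)) as [c [Hc E]].
  - intros; apply Derive_correct, smooth_ex_derive, Hf.
  - intros; apply continuity_pt_filterlim, smooth_continuous, Hf.
  - rewrite E. replace (/ h * (Derive f c * (z + h - z)) - Derive f z) with
      (Derive f c - Derive f z) by (field; exact Hh).
    apply Rle_trans with (1 := mean_value (Derive f) c z L (smooth_Derive _ Hf) HL).
    apply Rmult_le_compat_l; [generalize (HL 0) (Rabs_pos (Derive (Derive f) 0)); lra|].
    revert Hc. unfold Rmin, Rmax, Rabs. repeat destruct Rle_dec; repeat destruct Rcase_abs; lra.
Qed.

(** * Differentiation under a distribution *)

Section RealDistr.
Variable u : (R -> R) -> R.
Hypothesis Hu : is_real_distr u.

Lemma distr_plus f g : test_fun f -> test_fun g -> u (fun x => f x + g x) = u f + u g.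
Proof. apply Hu. Qed.

Lemma distr_scal c f : test_fun f -> u (fun x => c * f x) = c * u f.
Proof. apply Hu. Qed.

Lemma distr_lin a b f g : test_fun f -> test_fun g ->
  u (fun x => a * f x + b * g x) = a * u f + b * u g.
Proof.
  intros Hf Hg. rewrite distr_plus by now apply test_fun_scal. now rewrite !distr_scal.
Qed.

Lemma distr_zero : u (fun _ => 0) = 0.
Proof.
  replace (fun _ : R => 0) with (fun _ : R => 0 * 0) by (apply functional_extensionality; intros; ring).
  rewrite (distr_scal 0 (fun _ => 0)) by apply test_fun_const. ring.
Qed.

Lemma test_fun_rsum (F : nat -> R -> R) m : (forall i, test_fun (F i)) ->
  test_fun (fun x => rsum (fun i => F i x) m).
Proof.
  intros H. induction m as [|m IH]; simpl; [apply test_fun_const|].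
  apply test_fun_plus; [exact IH|apply H].
Qed.

Lemma distr_rsum (F : nat -> R -> R) m : (forall i, test_fun (F i)) ->
  u (fun x => rsum (fun i => F i x) m) = rsum (fun i => u (F i)) m.
Proof.
  intros H. induction m as [|m IH]; simpl; [apply distr_zero|].
  rewrite distr_plus; [now rewrite IH|now apply test_fun_rsum|apply H].
Qed.

(** The remainder [r] of the difference quotient is [O(h)] together with its derivatives up to the
    order [N] of [u], so the seminorm bound sends it to 0. The mean value estimates cost two
    derivatives, hence the bound on [f] up to [N + 2]. *)
Lemma is_derive_distr_shift f x : test_fun f ->
  is_derive (fun x => u (fun y => f (x + y))) x (u (fun y => Derive f (x + y))).
Proof.
  intros Hf. destruct (proj2 (proj2 Hu)) as [C [N [HC Hb]]].
  destruct (test_fun_bounded_n f (S (S N)) Hf) as [L [HL HfL]].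
  apply is_derive_Reals. intros eps Heps.
  assert (0 <= C * L) as HCL by nra.
  assert (0 < eps / (C * L + 1)) as Hd by (apply Rdiv_lt_0_compat; lra).
  exists (mkposreal _ Hd). intros h Hh Hlt. simpl in Hlt.
  set (r := fun y => 1 * (/ h * f (x + h + y) + (- / h) * f (x + y)) + (-1) * Derive f (x + y)).
  assert (test_fun (fun y => Derive f (x + y))) as T3 by now apply test_fun_shift, test_fun_Derive.
  assert (forall a, test_fun (fun y => f (a + y))) as T1 by (intros; now apply test_fun_shift).
  assert (test_fun (fun y => / h * f (x + h + y) + (- / h) * f (x + y))) as T2.
  { apply test_fun_plus; apply test_fun_scal, T1. }
  replace ((u (fun y => f (x + h + y)) - u (fun y => f (x + y))) / h - u (fun y => Derive f (x + y)))
    with (u r).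
  2: { unfold r. rewrite distr_lin, distr_lin by auto. field. exact Hh. }
  apply Rle_lt_trans with (C * (L * Rabs h)).
  - apply Hb.
    + unfold r. apply test_fun_plus; now apply test_fun_scal.
    + intros j y Hj. unfold r. rewrite Derive_n_lin; [|now apply test_fun_smooth|now apply test_fun_smooth].
      rewrite Derive_n_lin; [|now apply test_fun_smooth|now apply test_fun_smooth].
      rewrite !Derive_n_shift, Derive_n_Derive.
      replace (1 * (/ h * Derive_n f j (x + h + y) + - / h * Derive_n f j (x + y)) +
        -1 * Derive_n f (S j) (x + y)) with
        (/ h * (Derive_n f j (x + y + h) - Derive_n f j (x + y)) - Derive (Derive_n f j) (x + y)).
      2: { replace (x + h + y) with (x + y + h) by ring. simpl.
           change (Derive (fun x0 => Derive_n f j x0)) with (Derive (Derive_n f j)). ring. }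
      apply difference_quotient_bound; [now apply smooth_Derive_n, test_fun_smooth| |exact Hh].
      intros z. apply (HfL (S (S j))). lia.
  - apply Rmult_lt_compat_r with (r := C * L + 1) in Hlt; [|lra].
    replace (eps / (C * L + 1) * (C * L + 1)) with eps in Hlt by (field; lra).
    generalize (Rabs_pos h). nra.
Qed.

Lemma Derive_n_distr_shift f j : test_fun f ->
  Derive_n (fun x => u (fun y => f (x + y))) j = fun x => u (fun y => Derive_n f j (x + y)).
Proof.
  intros Hf. induction j as [|j IH]; [reflexivity|]. simpl. rewrite IH.
  apply functional_extensionality. intros x.
  apply is_derive_unique. apply (is_derive_distr_shift (Derive_n f j)).
  now apply test_fun_Derive_n.
Qed.

Lemma test_fun_distr_shift f : test_fun f -> test_fun (fun x => u (fun y => f (x + y))).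
Proof.
  intros Hf. split.
  - apply (smooth_coind (fun g => exists f, test_fun f /\ g = fun x => u (fun y => f (x + y))));
      [|now exists f].
    intros g (k & Hk & ->). exists (fun x => u (fun y => Derive k (x + y))). split.
    + exists (Derive k). split; [now apply test_fun_Derive|reflexivity].
    + intros x. now apply is_derive_distr_shift.
  - intros x. f_equal. apply functional_extensionality. intros y.
    replace (x + 2 * PI + y) with (x + y + 2 * PI) by ring. apply Hf.
Qed.
End RealDistr.

Lemma is_real_distr_lin a b u w : is_real_distr u -> is_real_distr w ->
  is_real_distr (fun f => a * u f + b * w f).
Proof.
  intros Hu Hw. split; [|split].
  - intros f g Hf Hg. rewrite (distr_plus u), (distr_plus w) by assumption. ring.
  - intros c f Hf. rewrite (distr_scal u), (distr_scal w) by assumption. ring.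
  - destruct (proj2 (proj2 Hu)) as [C [N [HC Hb]]].
    destruct (proj2 (proj2 Hw)) as [C' [N' [HC' Hb']]].
    exists (Rabs a * C + Rabs b * C'), (N + N')%nat. split.
    + generalize (Rabs_pos a) (Rabs_pos b). nra.
    + intros f M Hf HM. apply Rle_trans with (1 := Rabs_triang _ _). rewrite !Rabs_mult.
      assert (Rabs (u f) <= C * M) as H1 by (apply Hb; [exact Hf|intros; apply HM; lia]).
      assert (Rabs (w f) <= C' * M) as H2 by (apply Hb'; [exact Hf|intros; apply HM; lia]).
      generalize (Rabs_pos a) (Rabs_pos b). nra.
Qed.

(** Derivatives in [x] pass inside [w], so the estimate of [w] controls the function fed to [u]:
    constants multiply and orders add. *)
Lemma is_real_distr_rconv u w : is_real_distr u -> is_real_distr w -> is_real_distr (rconv u w).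
Proof.
  intros Hu Hw. unfold rconv. split; [|split].
  - intros f g Hf Hg. rewrite <- (distr_plus u Hu) by now apply test_fun_distr_shift.
    f_equal. apply functional_extensionality. intros x.
    apply (distr_plus w Hw (fun y => f (x + y)) (fun y => g (x + y))); now apply test_fun_shift.
  - intros c f Hf. rewrite <- (distr_scal u Hu) by now apply test_fun_distr_shift.
    f_equal. apply functional_extensionality. intros x.
    apply (distr_scal w Hw c (fun y => f (x + y))); now apply test_fun_shift.
  - destruct (proj2 (proj2 Hu)) as [C [N [HC Hb]]].
    destruct (proj2 (proj2 Hw)) as [C' [N' [HC' Hb']]].
    exists (C * C'), (N + N')%nat. split; [nra|]. intros f M Hf HM.
    rewrite Rmult_assoc. apply Hb; [now apply test_fun_distr_shift|].
    intros j x Hj. rewrite Derive_n_distr_shift by assumption.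
    apply Hb'; [now apply test_fun_shift, test_fun_Derive_n|].
    intros i y Hi. rewrite Derive_n_shift, Derive_n_comp. apply HM. lia.
Qed.

Lemma is_distr_conv f g : is_distr f -> is_distr g -> is_distr (conv f g).
Proof.
  intros [H1 H2] [H3 H4]. split; simpl.
  - replace (fun phi => rconv (fst f) (fst g) phi - rconv (snd f) (snd g) phi) with
      (fun phi => 1 * rconv (fst f) (fst g) phi + (-1) * rconv (snd f) (snd g) phi)
      by (apply functional_extensionality; intros; ring).
    apply is_real_distr_lin; now apply is_real_distr_rconv.
  - replace (fun phi => rconv (fst f) (snd g) phi + rconv (snd f) (fst g) phi) with
      (fun phi => 1 * rconv (fst f) (snd g) phi + 1 * rconv (snd f) (fst g) phi)
      by (apply functional_extensionality; intros; ring).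
    apply is_real_distr_lin; now apply is_real_distr_rconv.
Qed.

(** By the convention for [Nat.pred], [conv_pow f 0] is [f], so the recursion starts at 1. *)
Lemma conv_pow_S f p : (1 <= p)%nat -> conv_pow f (S p) = conv f (conv_pow f p).
Proof. intros Hp. destruct p as [|p]; [lia|reflexivity]. Qed.

Lemma conv_pow_ind (Q : nat -> distr -> Prop) f :
  Q 1%nat f -> (forall j g, (1 <= j)%nat -> Q j g -> Q (S j) (conv f g)) ->
  forall p, (1 <= p)%nat -> Q p (conv_pow f p).
Proof.
  intros H1 HS p Hp. induction Hp as [|p Hp IH]; [exact H1|].
  rewrite conv_pow_S by exact Hp. now apply HS.
Qed.

Lemma is_distr_conv_pow f p : (1 <= p)%nat -> is_distr f -> is_distr (conv_pow f p).
Proof.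
  intros Hp Hf. apply (conv_pow_ind (fun _ g => is_distr g)); [exact Hf| |exact Hp].
  intros; now apply is_distr_conv.
Qed.

(** * Supports *)

Definition vanishes_near (A : R -> Prop) (phi : R -> R) : Prop :=
  exists eps, 0 < eps /\ forall x y, A x -> Rabs (y - x) < eps -> phi y = 0.

(** The dual form of an inclusion of supports: it consists of equations [u phi = 0], which pass
    through convolutions. *)
Definition carried (A : R -> Prop) (u : (R -> R) -> R) : Prop :=
  forall phi, test_fun phi -> vanishes_near A phi -> u phi = 0.

Definition carried_pair (A : R -> Prop) (f : distr) : Prop :=
  carried A (fst f) /\ carried A (snd f).

(** The cosine measures the distance to [2 PI Z] smoothly, so [cos (x - c) - cos d] is the seed of a
    periodic bump of radius [d]. *)
Lemma cos_le_of_far z d : 0 < d <= PI ->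
  (forall m : Z, d <= Rabs (z + 2 * PI * IZR m)) -> cos z <= cos d.
Proof.
  intros Hd H. destruct (reduce_mod (2 * PI) (- PI) z) as [k Hk]; [lra|].
  specialize (H k). rewrite <- (periodic_IZR cos (2 * PI) k z).
  2: { intros x. rewrite cos_plus, cos_2PI, sin_2PI. ring. }
  set (y := z + 2 * PI * IZR k) in *.
  assert (Rabs y <= PI) as Hy by (apply Rabs_le; lra).
  replace (cos y) with (cos (Rabs y)).
  - apply cos_decr_1; try lra.
  - unfold Rabs. destruct (Rcase_abs y); [apply cos_neg|reflexivity].
Qed.

Lemma cos_gt_of_near z d : 0 < d <= PI -> Rabs z < d -> cos d < cos z.
Proof.
  intros Hd Hz. replace (cos z) with (cos (Rabs z)).
  - generalize (Rabs_pos z). intros. apply cos_decreasing_1; lra.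
  - unfold Rabs. destruct (Rcase_abs z); [apply cos_neg|reflexivity].
Qed.

Lemma rsum_pos F m i : (forall i, 0 <= F i) -> (i < m)%nat -> 0 < F i -> 0 < rsum F m.
Proof.
  intros HF Hi HFi.
  assert (forall k, 0 <= rsum F k) as H0.
  { intros k. induction k as [|k IH]; simpl; [lra|]. generalize (HF k). lra. }
  induction m as [|m IH]; [lia|]. simpl.
  destruct (Nat.eq_dec i m) as [->|Hne]; [generalize (H0 m); lra|].
  generalize (HF m) (IH ltac:(lia)). lra.
Qed.

(** The bumps [flat 0 (cos (x - c i) - cos d)] live within [d] of [c i] modulo [2 PI]; consecutive
    centres are closer than [d], so the sum [W] is positive everywhere and can be divided by. *)
Lemma test_fun_partition d : 0 < d <= PI -> exists (m : nat) (psi : nat -> R -> R),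
  (forall i, test_fun (psi i)) /\
  (forall x, rsum (fun i => psi i x) m = 1) /\
  (forall i, (i < m)%nat -> exists c, 0 <= c <= 2 * PI /\
     forall y, (forall k : Z, d <= Rabs (y - c + 2 * PI * IZR k)) -> psi i y = 0).
Proof.
  intros Hd. assert (0 < PI) as HPI by apply PI_RGT_0.
  destruct (nat_above (2 * PI / d + 1)) as [m0 Hm]. set (m := S m0) in *.
  assert (0 < INR m) as Hm0 by (apply lt_0_INR; lia).
  assert (2 * PI / INR m < d) as Hmd.
  { apply Rmult_lt_reg_r with (INR m); [exact Hm0|].
    replace (2 * PI / INR m * INR m) with (2 * PI) by (field; lra).
    apply Rmult_le_compat_r with (r := d) in Hm; [|lra].
    replace ((2 * PI / d + 1) * d) with (2 * PI + d) in Hm by (field; lra). lra. }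
  set (c := fun i => 2 * PI / INR m * INR i).
  set (T := fun i x => flat 0 (cos (- c i + x) - cos d)).
  assert (forall i, test_fun (T i)) as HT.
  { intros i. apply (test_fun_comp (fun y => flat 0 (y - cos d))).
    - apply (smooth_comp (flat 0)); [apply smooth_flat|].
      apply smooth_minus; [apply smooth_id|apply smooth_const].
    - apply (test_fun_shift cos). split; [apply smooth_sin_cos|].
      intros x. rewrite cos_plus, cos_2PI, sin_2PI. ring. }
  set (W := fun x => rsum (fun i => T i x) m).
  assert (test_fun W) as HW by now apply test_fun_rsum.
  assert (forall x, 0 < W x) as HWp.
  { intros x. destruct (reduce_mod (2 * PI) 0 x) as [k Hk]; [lra|].
    rewrite <- (periodic_IZR W (2 * PI) k x) by apply HW.
    set (y := x + 2 * PI * IZR k) in *.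
    destruct (nfloor_ex (y * INR m / (2 * PI))) as [i Hi].
    { apply Rdiv_le_0_compat; [nra|lra]. }
    assert (y * INR m / (2 * PI) * (2 * PI / INR m) = y) as Ey by (field; lra).
    assert (0 < 2 * PI / INR m) as Hpm by (apply Rdiv_lt_0_compat; lra).
    assert (2 * PI / INR m * INR m = 2 * PI) as Em by (field; lra).
    assert (0 <= y - c i < 2 * PI / INR m) as Hyi by (unfold c; nra).
    apply rsum_pos with i.
    - intros; apply flat_nonneg.
    - apply INR_lt. unfold c in Hyi. nra.
    - apply flat_pos. assert (cos d < cos (- c i + y)); [|lra].
      apply cos_gt_of_near; [exact Hd|]. apply Rabs_def1; lra. }
  exists m, (fun i x => T i x * / W x). split; [|split].
  - intros i. apply test_fun_mult; [apply HT|]. split.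
    + apply smooth_inv; [now apply test_fun_smooth|]. intros x. generalize (HWp x). lra.
    + intros x. f_equal. apply HW.
  - intros x. rewrite <- (Rinv_r (W x)) by (generalize (HWp x); lra).
    unfold W at 2. rewrite Rmult_comm, <- rsum_scal. apply rsum_ext. intros; ring.
  - intros i Hi. exists (c i). split.
    + assert (0 < 2 * PI / INR m) as Hpm by (apply Rdiv_lt_0_compat; lra).
      assert (2 * PI / INR m * INR m = 2 * PI) as Em by (field; lra).
      apply lt_INR in Hi. generalize (pos_INR i). unfold c. nra.
    + intros y Hy. unfold T. rewrite flat_zero; [ring|].
      assert (cos (- c i + y) <= cos d); [|lra]. apply cos_le_of_far; [exact Hd|].
      intros k. replace (- c i + y) with (y - c i) by ring. apply Hy.
Qed.

(** Close to a point outside the support, [f] kills test functions by definition; close to a point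
    of the support, [phi] itself is zero. Compactness makes the radius uniform, and a partition of
    unity cuts [phi] into pieces that are killed one by one. *)
Lemma supp_subset_carried f A : is_distr f -> subset (supp f) A -> carried_pair A f.
Proof.
  intros Hf Hs.
  enough (forall phi, test_fun phi -> vanishes_near A phi -> fst f phi = 0 /\ snd f phi = 0) as H
    by (split; intros phi H1 H2; apply (H phi H1 H2)).
  intros phi Hphi [eps [Heps Hvan]].
  set (Loc := fun d x => forall psi, test_fun psi ->
    (forall y, (forall m : Z, d <= Rabs (y - x + 2 * PI * IZR m)) -> psi y = 0) ->
    fst f (fun y => phi y * psi y) = 0 /\ snd f (fun y => phi y * psi y) = 0).
  (* The factor 2 leaves room for moving the centre: if [|x - t| < delta t] and [d <= delta t], the
     ball of radius [d] around [x] lies in that of radius [2 delta t] around [t]. *)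
  assert (forall x, exists d : posreal, Loc (2 * d) x) as Hloc.
  { intros x. destruct (classic (supp f x)) as [Hx|Hx].
    - assert (0 < eps / 2) as He by lra. exists (mkposreal _ He). simpl. intros psi Hpsi Hv.
      replace (fun y => phi y * psi y) with (fun _ : R => 0).
      + split; apply distr_zero; apply Hf.
      + apply functional_extensionality. intros y.
        destruct (classic (exists m : Z, Rabs (y - x + 2 * PI * IZR m) < eps)) as [[m Hm]|Hn].
        * rewrite <- (periodic_IZR phi (2 * PI) m y) by apply Hphi.
          rewrite (Hvan x (y + 2 * PI * IZR m)); [ring|now apply Hs|].
          replace (y + 2 * PI * IZR m - x) with (y - x + 2 * PI * IZR m) by ring. exact Hm.
        * rewrite Hv; [ring|]. intros m. apply Rnot_lt_le. intros Hm. apply Hn. exists m. lra.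
    - apply not_all_ex_not in Hx. destruct Hx as [d Hx].
      apply imply_to_and in Hx. destruct Hx as [Hd Hx].
      assert (0 < d / 2) as He by lra. exists (mkposreal _ He). simpl. intros psi Hpsi Hv.
      apply NNPP. intros Hne. apply Hx. exists (fun y => phi y * psi y). split; [|split].
      + now apply test_fun_mult.
      + intros y Hy. rewrite Hv; [ring|]. intros m. generalize (Hy m). lra.
      + apply not_and_or in Hne. exact Hne. }
  set (delta := fun x => proj1_sig (constructive_indefinite_description _ (Hloc x))).
  assert (forall x, Loc (2 * delta x) x) as Hdelta.
  { intros x. unfold delta. apply (proj2_sig (constructive_indefinite_description _ (Hloc x))). }
  destruct (compactness_value_1d 0 (2 * PI) delta) as [d0 Hd0].
  assert (0 < PI) as HPI by apply PI_RGT_0.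
  set (d := Rmin d0 PI).
  assert (0 < d <= PI) as Hd by (split; [apply Rmin_pos; [apply cond_pos|lra]|apply Rmin_r]).
  assert (d <= d0) as Hdd by apply Rmin_l.
  assert (forall x, 0 <= x <= 2 * PI -> Loc d x) as Hunif.
  { intros x Hx. apply NNPP. intros Hn. apply (Hd0 x Hx). intros (t & Ht & Hxt & Hdt).
    apply Hn. intros psi Hpsi Hv. apply (Hdelta t psi Hpsi). intros y Hy. apply Hv.
    intros m. specialize (Hy m).
    replace (y - t + 2 * PI * IZR m) with ((y - x + 2 * PI * IZR m) + (x - t)) in Hy by ring.
    generalize (Rabs_triang (y - x + 2 * PI * IZR m) (x - t)). lra. }
  destruct (test_fun_partition d Hd) as (m & psi & Hpsi & Hsum & Hsup).
  replace phi with (fun x => rsum (fun i => phi x * psi i x) m).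
  2: { apply functional_extensionality. intros x. rewrite rsum_scal, Hsum. ring. }
  assert (forall i, test_fun (fun x => phi x * psi i x)) as Ht by (intros; now apply test_fun_mult).
  rewrite !(distr_rsum _) by (apply Hf || exact Ht).
  split; rewrite <- (Rmult_0_r (INR m)), <- rsum_const; apply rsum_ext; intros i Hi;
    destruct (Hsup i Hi) as [c [Hc Hv]]; apply (Hunif c Hc (psi i) (Hpsi i) Hv).
Qed.

(** * Rotated intervals as periodic sets *)

Definition periodic_arc (P a b : R) : R -> Prop := fun x =>
  exists k : Z, a <= x + P * IZR k <= b.

(** The rotations by [2 PI k / n] and the period [2 PI] together generate the translations by
    multiples of [2 PI / n]. *)
Lemma rot_union_arc n a b : (1 <= n)%nat ->
  set_eq (rot_union n (arc a b)) (periodic_arc (2 * PI / INR n) a b).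
Proof.
  intros Hn x. assert (0 < INR n) as Hn0 by (apply lt_0_INR; lia).
  unfold rot_union, shift, arc, periodic_arc. split.
  - intros [k [Hk [m Hm]]]. exists (Z.of_nat n * m - Z.of_nat k)%Z.
    rewrite minus_IZR, mult_IZR, <- !INR_IZR_INZ.
    replace (x + 2 * PI / INR n * (INR n * IZR m - INR k)) with
      (x - 2 * PI * INR k / INR n + 2 * PI * IZR m) by (field; lra). exact Hm.
  (* [j = n q - k] with [0 <= k < n]: the remainder of [-j] gives the rotation, the quotient the
     number of full turns. *)
  - intros [j Hj]. set (k := Z.to_nat ((- j) mod Z.of_nat n)).
    assert (0 <= (- j) mod Z.of_nat n < Z.of_nat n)%Z as Hk by (apply Z.mod_pos_bound; lia).
    exists k. split; [unfold k; lia|]. exists (- ((- j) / Z.of_nat n))%Z.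
    assert (j = Z.of_nat n * (- ((- j) / Z.of_nat n)) - Z.of_nat k)%Z as Ej.
    { unfold k. rewrite Z2Nat.id by lia. generalize (Z.div_mod (- j) (Z.of_nat n)). lia. }
    apply (f_equal IZR) in Ej. rewrite minus_IZR, mult_IZR, <- !INR_IZR_INZ in Ej.
    rewrite Ej in Hj. set (q := IZR (- (- j / Z.of_nat n))) in *.
    replace (x - 2 * PI * INR k / INR n + 2 * PI * q) with
      (x + 2 * PI / INR n * (INR n * q - INR k)) by (field; lra). exact Hj.
Qed.

Lemma periodic_arc_shift P a b x k : periodic_arc P a b x -> periodic_arc P a b (x + P * IZR k).
Proof.
  intros [j Hj]. exists (j - k)%Z. rewrite minus_IZR.
  replace (x + P * IZR k + P * (IZR j - IZR k)) with (x + P * IZR j) by ring. exact Hj.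
Qed.

Lemma periodic_arc_closed P a b x : 0 < P -> ~ periodic_arc P a b x ->
  exists eps, 0 < eps /\ forall y, Rabs (y - x) < eps -> ~ periodic_arc P a b y.
Proof.
  intros HP Hx. destruct (reduce_mod P a x HP) as [k Hk].
  assert (b < x + P * IZR k) as Hb.
  { apply Rnot_le_lt. intros H. apply Hx. exists k. lra. }
  exists (Rmin (x + P * IZR k - b) (a + P - (x + P * IZR k))).
  split; [apply Rmin_pos; lra|]. intros y Hy [j Hj].
  assert (Rabs (y - x) < x + P * IZR k - b /\ Rabs (y - x) < a + P - (x + P * IZR k)) as [H1 H2].
  { split; (eapply Rlt_le_trans; [exact Hy|]); [apply Rmin_l|apply Rmin_r]. }
  apply Rabs_def2 in H1. apply Rabs_def2 in H2.
  destruct (Z.lt_trichotomy j k) as [H|[->|H]]; [| lra |].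
  - assert (IZR j <= IZR k - 1) by (rewrite <- minus_IZR; apply IZR_le; lia). nra.
  - assert (IZR k + 1 <= IZR j) by (rewrite <- plus_IZR; apply IZR_le; lia). nra.
Qed.

Lemma carried_supp_subset n f a b : (1 <= n)%nat ->
  carried_pair (periodic_arc (2 * PI / INR n) a b) f ->
  subset (supp f) (periodic_arc (2 * PI / INR n) a b).
Proof.
  intros Hn [H1 H2] x Hx. assert (0 < INR n) as Hn0 by (apply lt_0_INR; lia).
  set (P := 2 * PI / INR n) in *.
  assert (0 < P) as HP by (apply Rdiv_lt_0_compat; [generalize PI_RGT_0; lra|exact Hn0]).
  apply NNPP. intros Hnx. destruct (periodic_arc_closed P a b x HP Hnx) as [eps [Heps Hcl]].
  destruct (Hx (eps / 2) ltac:(lra)) as (phi & Hphi & Hv & Hne).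
  assert (vanishes_near (periodic_arc P a b) phi) as Hvan.
  { exists (eps / 2). split; [lra|]. intros z y Hz Hy. apply Hv. intros m.
    apply Rnot_lt_le. intros Hm.
    apply (Hcl (z + P * IZR (Z.of_nat n * m))); [|now apply periodic_arc_shift].
    rewrite mult_IZR, <- INR_IZR_INZ.
    replace (P * (INR n * IZR m)) with (2 * PI * IZR m) by (unfold P; field; lra).
    replace (z + 2 * PI * IZR m - x) with (- (y - z) + (y - x + 2 * PI * IZR m)) by ring.
    eapply Rle_lt_trans; [apply Rabs_triang|]. rewrite Rabs_Ropp. lra. }
  destruct Hne as [Hne|Hne]; apply Hne; auto.
Qed.

(** The radius in [vanishes_near] is uniform, so it can be split in halves between the two
    variables. *)
Lemma carried_rconv u w (A B C : R -> Prop) : is_real_distr u -> is_real_distr w ->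
  carried A u -> carried B w -> (forall x y, A x -> B y -> C (x + y)) -> carried C (rconv u w).
Proof.
  intros Hu Hw HA HB HC phi Hphi [eps [Heps Hv]]. unfold rconv.
  apply HA; [now apply test_fun_distr_shift|].
  exists (eps / 2). split; [lra|]. intros x x' Hx Hxx'.
  apply HB; [now apply test_fun_shift|].
  exists (eps / 2). split; [lra|]. intros y y' Hy Hyy'.
  apply (Hv (x + y)); [now apply HC|].
  replace (x' + y' - (x + y)) with ((x' - x) + (y' - y)) by ring.
  eapply Rle_lt_trans; [apply Rabs_triang|]. lra.
Qed.

Lemma carried_conv f g (A B C : R -> Prop) : is_distr f -> is_distr g ->
  carried_pair A f -> carried_pair B g -> (forall x y, A x -> B y -> C (x + y)) ->
  carried_pair C (conv f g).
Proof.
  intros [F1 F2] [G1 G2] [A1 A2] [B1 B2] HC. split; intros phi Hphi Hv; simpl;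
    rewrite !(carried_rconv _ _ A B C) by auto; ring.
Qed.

Lemma carried_conv_pow P f a b p : (1 <= p)%nat -> is_distr f ->
  carried_pair (periodic_arc P a b) f ->
  carried_pair (periodic_arc P (INR p * a) (INR p * b)) (conv_pow f p).
Proof.
  intros Hp Hf Hc.
  apply (conv_pow_ind (fun p g => is_distr g /\
    carried_pair (periodic_arc P (INR p * a) (INR p * b)) g)); [| |exact Hp].
  - split; [exact Hf|]. simpl. now rewrite !Rmult_1_l.
  - intros j g Hj [Hg Hcg]. split; [now apply is_distr_conv|].
    apply (carried_conv f g _ _ _ Hf Hg Hc Hcg). intros x y [k Hk] [l Hl].
    exists (k + l)%Z. rewrite plus_IZR, S_INR. lra.
Qed.

(** * Periodic coordinates and push-forwards *)

(** As [up] is the integer part plus one, this is the representative of [x] modulo [P] in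
    [[a, a + P)]. *)
Definition wrap (P a x : R) : R := x + P * (1 - IZR (up ((x - a) / P))).

Lemma wrap_eq P a x k : 0 < P -> a <= x + P * IZR k < a + P -> wrap P a x = x + P * IZR k.
Proof.
  intros HP Hk. unfold wrap. rewrite <- (tech_up ((x - a) / P) (1 - k)).
  - rewrite minus_IZR. ring.
  - rewrite minus_IZR. apply Rmult_lt_reg_r with (1 := HP).
    replace ((x - a) / P * P) with (x - a) by (field; lra). lra.
  - rewrite minus_IZR. apply Rmult_le_reg_r with (1 := HP).
    replace (((x - a) / P + 1) * P) with (x - a + P) by (field; lra). lra.
Qed.

Lemma wrap_periodic P a x : 0 < P -> wrap P a (x + P) = wrap P a x.
Proof.
  intros HP. destruct (reduce_mod P a x HP) as [k Hk].
  rewrite (wrap_eq P a x k HP Hk), (wrap_eq P a (x + P) (k - 1) HP); rewrite minus_IZR; lra.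
Qed.

(** [wrap] jumps only at the translates of [a], and there [g] is zero on both sides. *)
Lemma smooth_wrap P a eta g : 0 < P -> 0 < eta -> smooth g ->
  (forall x, x <= a + eta -> g x = 0) -> (forall x, a + P - eta <= x -> g x = 0) ->
  smooth (fun x => g (wrap P a x)).
Proof.
  intros HP He Hg Hl Hr. apply smooth_loc. intros x.
  destruct (reduce_mod P a x HP) as [k Hk]. destruct (Req_dec (x + P * IZR k) a) as [Ea|Na].
  - exists (fun _ => 0). split; [apply smooth_const|].
    assert (0 < Rmin eta P) as Hm by now apply Rmin_pos.
    exists (mkposreal _ Hm). intros y Hy.
    unfold ball in Hy; simpl in Hy. unfold AbsRing_ball, abs, minus, plus, opp in Hy; simpl in Hy.
    assert (Rabs (y + - x) < eta /\ Rabs (y + - x) < P) as [H1 H2].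
    { split; (eapply Rlt_le_trans; [exact Hy|]); [apply Rmin_l|apply Rmin_r]. }
    apply Rabs_def2 in H1. apply Rabs_def2 in H2.
    destruct (Rle_dec a (y + P * IZR k)) as [H|H].
    + rewrite (wrap_eq P a y k HP) by lra. apply Hl. lra.
    + rewrite (wrap_eq P a y (k + 1) HP); rewrite plus_IZR; [apply Hr|]; lra.
  - exists (fun y => g (P * IZR k + y)). split; [now apply smooth_shift|].
    assert (0 < Rmin (x + P * IZR k - a) (a + P - (x + P * IZR k))) as Hm by (apply Rmin_pos; lra).
    exists (mkposreal _ Hm). intros y Hy.
    unfold ball in Hy; simpl in Hy. unfold AbsRing_ball, abs, minus, plus, opp in Hy; simpl in Hy.
    assert (Rabs (y + - x) < x + P * IZR k - a /\ Rabs (y + - x) < a + P - (x + P * IZR k)) as [H1 H2].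
    { split; (eapply Rlt_le_trans; [exact Hy|]); [apply Rmin_l|apply Rmin_r]. }
    apply Rabs_def2 in H1. apply Rabs_def2 in H2.
    rewrite (wrap_eq P a y k HP) by lra. f_equal. ring.
Qed.

Definition coordinate (P a b : R) (lam : R -> R) : Prop :=
  smooth lam /\ (forall x, lam (x + P) = lam x) /\ (forall x, a <= x <= b -> lam x = x).

Lemma coordinate_exists P a b : a <= b -> b - a < P -> exists lam, coordinate P a b lam.
Proof.
  (* A quarter of the gap: with base point [a - 2 eta] the cutoffs reach out to [a - eta] and
     [b + eta], and a margin [eta] remains before either end of the period. *)
  intros Hab HP. set (eta := (P - (b - a)) / 4). assert (0 < eta) as He by (unfold eta; lra).
  destruct (smooth_step b (b + eta) ltac:(lra)) as (S1 & Hs1 & _ & H11 & H10).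
  destruct (smooth_step (- a) (- a + eta) ltac:(lra)) as (S2 & Hs2 & _ & H21 & H20).
  set (g := fun x => x * (S1 x * S2 (- x))).
  assert (smooth g) as Hg.
  { apply smooth_mult; [apply smooth_id|]. apply smooth_mult; [exact Hs1|].
    apply (smooth_comp S2); [exact Hs2|apply smooth_opp, smooth_id]. }
  exists (fun x => g (wrap P (a - 2 * eta) x)). split; [|split].
  - apply (smooth_wrap P (a - 2 * eta) eta g ltac:(lra) He Hg); intros x Hx; unfold g.
    + rewrite (H20 (- x)) by lra. ring.
    + rewrite (H10 x) by (unfold eta in *; lra). ring.
  - intros x. now rewrite wrap_periodic by lra.
  - intros x Hx. rewrite (wrap_eq P (a - 2 * eta) x 0).
    + unfold g. rewrite Rmult_0_r, Rplus_0_r, H11, H21 by lra. ring.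
    + lra.
    + rewrite Rmult_0_r, Rplus_0_r. unfold eta in *. lra.
Qed.

Lemma coordinate_mod P a b lam x k : coordinate P a b lam ->
  a <= x + P * IZR k <= b -> lam x = x + P * IZR k.
Proof.
  intros (_ & Hp & Hl) Hk. rewrite <- (periodic_IZR lam P k x Hp). now apply Hl.
Qed.

Lemma test_fun_of_period n f : (1 <= n)%nat -> smooth f ->
  (forall x, f (x + 2 * PI / INR n) = f x) -> test_fun f.
Proof.
  intros Hn Hf Hp. split; [exact Hf|]. intros x.
  assert (0 < INR n) by (apply lt_0_INR; lia).
  rewrite <- (periodic_IZR f _ (Z.of_nat n) x Hp), <- INR_IZR_INZ. f_equal. field. lra.
Qed.

Section Pushforward.
Variables (kap : R -> R) (B : R).
Hypotheses (Hkap : test_fun kap) (HB : forall x, Rabs (kap x) <= B).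

(** One derivative of [sig g(kap)] gives [sig' g(kap) + (sig kap') g'(kap)], two terms of the same
    shape; hence the induction runs over all weights [sig] at once. *)
Lemma Derive_n_pullback_bound j : forall sig, test_fun sig -> exists K, 0 <= K /\
  forall g M, smooth g ->
    (forall i x, (i <= j)%nat -> - B <= x <= B -> Rabs (Derive_n g i x) <= M) ->
    forall x, Rabs (Derive_n (fun x => sig x * g (kap x)) j x) <= K * M.
Proof.
  induction j as [|j IH]; intros sig Hsig.
  - destruct (test_fun_bounded sig Hsig) as [K [HK H]]. exists K. split; [exact HK|].
    intros g M Hg HM x. simpl. rewrite Rabs_mult.
    apply Rmult_le_compat; try apply Rabs_pos; [apply H|].
    apply (HM 0%nat); [lia|]. apply Rabs_le_between, HB.
  - destruct (IH (Derive sig) (test_fun_Derive _ Hsig)) as [K1 [HK1 H1]].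
    destruct (IH (fun x => sig x * Derive kap x)
      (test_fun_mult _ _ Hsig (test_fun_Derive _ Hkap))) as [K2 [HK2 H2]].
    exists (K1 + K2). split; [lra|]. intros g M Hg HM x.
    rewrite <- Derive_n_Derive.
    assert (forall h, smooth h -> smooth (fun x => h (kap x))) as Hcomp.
    { intros h Hh. apply (smooth_comp h); [exact Hh|now apply test_fun_smooth]. }
    replace (Derive (fun x => sig x * g (kap x))) with
      (fun x => 1 * (Derive sig x * g (kap x)) + 1 * ((sig x * Derive kap x) * Derive g (kap x))).
    + rewrite Derive_n_lin.
      * rewrite !Rmult_1_l. apply Rle_trans with (1 := Rabs_triang _ _).
        rewrite Rmult_plus_distr_r. apply Rplus_le_compat.
        -- apply H1; [exact Hg|]. intros; apply HM; [lia|assumption].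
        -- apply (H2 (Derive g)); [now apply smooth_Derive|].
           intros. rewrite Derive_n_Derive. apply HM; [lia|assumption].
      * apply smooth_mult; [now apply test_fun_smooth, test_fun_Derive|now apply Hcomp].
      * apply smooth_mult; [|now apply Hcomp, smooth_Derive].
        now apply test_fun_smooth, test_fun_mult; [|apply test_fun_Derive].
    + apply functional_extensionality. intros y. symmetry. apply is_derive_unique.
      assert (is_derive sig y (Derive sig y)) as D1
        by now apply Derive_correct, smooth_ex_derive, test_fun_smooth.
      assert (is_derive (fun x => g (kap x)) y (Derive kap y * Derive g (kap y))) as D2.
      { apply (is_derive_comp g kap); apply Derive_correct, smooth_ex_derive;
          [exact Hg|now apply test_fun_smooth]. }
      apply (is_derive_eq _ _ _ _ (is_derive_mult _ _ _ _ _ D1 D2 Rmult_comm)).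
      unfold mult, plus; simpl. ring.
Qed.

Lemma Derive_n_pullback_bound_le N sig : test_fun sig -> exists K, 0 <= K /\
  forall g M, smooth g ->
    (forall i x, (i <= N)%nat -> - B <= x <= B -> Rabs (Derive_n g i x) <= M) ->
    forall j x, (j <= N)%nat -> Rabs (Derive_n (fun x => sig x * g (kap x)) j x) <= K * M.
Proof.
  intros Hsig. induction N as [|N [K [HK H]]].
  - destruct (Derive_n_pullback_bound 0 sig Hsig) as [K [HK H]]. exists K. split; [exact HK|].
    intros g M Hg HM j x Hj. replace j with 0%nat by lia. now apply H.
  - destruct (Derive_n_pullback_bound (S N) sig Hsig) as [K' [HK' H']].
    exists (K + K'). split; [lra|]. intros g M Hg HM j x Hj.
    assert (0 <= M) as HM0.
    { generalize (HM 0%nat (kap 0) ltac:(lia) (proj1 (Rabs_le_between _ _) (HB 0)))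
        (Rabs_pos (Derive_n g 0 (kap 0))). lra. }
    destruct (Nat.eq_dec j (S N)) as [->|Hne].
    + generalize (H' g M Hg HM x). nra.
    + assert (Rabs (Derive_n (fun x => sig x * g (kap x)) j x) <= K * M) as G; [|nra].
      apply H; [exact Hg| |lia]. intros; apply HM; [lia|assumption].
Qed.

(** The image of [sig u] under [kap]: a periodic distribution becomes a functional on smooth
    functions of the line, where exponentials are available. *)
Definition pushforward (u : (R -> R) -> R) (sig g : R -> R) : R :=
  u (fun x => sig x * g (kap x)).

Lemma test_fun_pullback sig g : test_fun sig -> smooth g -> test_fun (fun x => sig x * g (kap x)).
Proof. intros Hs Hg. apply test_fun_mult; [exact Hs|now apply test_fun_comp]. Qed.

Lemma linear_pushforward u sig : is_real_distr u -> test_fun sig ->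
  linear_on_smooth (pushforward u sig).
Proof.
  intros Hu Hs. unfold pushforward. split.
  - intros f g Hf Hg. rewrite <- (distr_plus u Hu) by now apply test_fun_pullback.
    f_equal. apply functional_extensionality; intros; ring.
  - intros c f Hf. rewrite <- (distr_scal u Hu) by now apply test_fun_pullback.
    f_equal. apply functional_extensionality; intros; ring.
Qed.

Lemma order_pushforward u sig : is_real_distr u -> test_fun sig ->
  exists N, order_at_most N (- B) B (pushforward u sig).
Proof.
  intros Hu Hs. destruct (proj2 (proj2 Hu)) as [C [N [HC Hb]]]. exists N.
  destruct (Derive_n_pullback_bound_le N sig Hs) as [K [HK H]].
  exists (C * K). split; [nra|]. intros g M Hg HM. rewrite Rmult_assoc.
  apply Hb; [now apply test_fun_pullback|]. intros. now apply H.
Qed.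
End Pushforward.

Lemma linear_on_smooth_lin a b mu nu : linear_on_smooth mu -> linear_on_smooth nu ->
  linear_on_smooth (fun g => a * mu g + b * nu g).
Proof.
  intros [H1 H2] [H3 H4]. split.
  - intros. rewrite H1, H3 by assumption. ring.
  - intros. rewrite H2, H4 by assumption. ring.
Qed.

Lemma order_at_most_lin a b N N' A B mu nu : order_at_most N A B mu -> order_at_most N' A B nu ->
  order_at_most (N + N') A B (fun g => a * mu g + b * nu g).
Proof.
  intros [C [HC Hb]] [C' [HC' Hb']]. exists (Rabs a * C + Rabs b * C'). split.
  - generalize (Rabs_pos a) (Rabs_pos b). nra.
  - intros g M Hg HM. apply Rle_trans with (1 := Rabs_triang _ _). rewrite !Rabs_mult.
    assert (Rabs (mu g) <= C * M) as H1 by (apply Hb; [exact Hg|intros; apply HM; [lia|lra]]).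
    assert (Rabs (nu g) <= C' * M) as H2 by (apply Hb'; [exact Hg|intros; apply HM; [lia|lra]]).
    generalize (Rabs_pos a) (Rabs_pos b). nra.
Qed.

(** * Growth of functionals on truncated exponentials *)

Lemma Derive_zero_right chi r : (forall x, r < x -> chi x = 0) -> forall x, r < x -> Derive chi x = 0.
Proof.
  intros H x Hx. rewrite <- (Derive_const 0 x). apply Derive_ext_loc.
  exists (mkposreal (x - r) ltac:(lra)). intros y Hy.
  unfold ball in Hy; simpl in Hy. unfold AbsRing_ball, abs, minus, plus, opp in Hy; simpl in Hy.
  apply Rabs_def2 in Hy. apply H. lra.
Qed.

(** A derivative produces either a factor [s] or [Derive chi], which again vanishes beyond [r];
    hence [chi] is quantified inside the induction. *)
Lemma exp_cutoff_bound A B r j : forall chi, smooth chi -> (forall x, r < x -> chi x = 0) ->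
  exists K, 0 <= K /\ forall s x, 1 <= s -> A <= x <= B ->
    Rabs (Derive_n (fun x => chi x * exp (s * x)) j x) <= K * s ^ j * exp (s * r).
Proof.
  induction j as [|j IH]; intros chi Hchi Hz.
  - destruct (smooth_bounded chi A B Hchi) as [K [HK H]]. exists K. split; [exact HK|].
    intros s x Hs Hx. simpl. rewrite Rmult_1_r.
    destruct (Rlt_dec r x) as [Hr|Hr].
    + rewrite Hz by exact Hr. rewrite Rmult_0_l, Rabs_R0.
      apply Rmult_le_pos; [exact HK|left; apply exp_pos].
    + rewrite Rabs_mult, (Rabs_right (exp _)) by (left; apply exp_pos).
      apply Rmult_le_compat; [apply Rabs_pos|left; apply exp_pos|now apply H|].
      apply exp_le. nra.
  - destruct (IH chi Hchi Hz) as [K1 [HK1 H1]].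
    destruct (IH (Derive chi) (smooth_Derive _ Hchi) (Derive_zero_right _ _ Hz)) as [K2 [HK2 H2]].
    exists (K1 + K2). split; [lra|]. intros s x Hs Hx. rewrite <- Derive_n_Derive.
    replace (Derive (fun x => chi x * exp (s * x))) with
      (fun x => s * (chi x * exp (s * x)) + 1 * (Derive chi x * exp (s * x))).
    + rewrite Derive_n_lin.
      2,3: apply smooth_mult; [|apply smooth_exp_scal]; auto using smooth_Derive.
      rewrite Rmult_1_l. apply Rle_trans with (1 := Rabs_triang _ _).
      rewrite Rabs_mult, (Rabs_right s) by lra.
      generalize (H1 s x Hs Hx) (H2 s x Hs Hx). intros G1 G2.
      assert (0 < s ^ j) as Hsj by (apply pow_lt; lra).
      assert (0 < exp (s * r)) as He by apply exp_pos. simpl pow.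
      assert (0 <= K2 * s ^ j * exp (s * r)) as G3.
      { apply Rmult_le_pos; [apply Rmult_le_pos; lra|lra]. }
      replace ((K1 + K2) * (s * s ^ j) * exp (s * r)) with
        (s * (K1 * s ^ j * exp (s * r)) + s * (K2 * s ^ j * exp (s * r))) by ring.
      apply Rplus_le_compat; [apply Rmult_le_compat_l; lra|nra].
    + apply functional_extensionality. intros y. symmetry. apply is_derive_unique.
      assert (ex_derive chi y) as D by now apply smooth_ex_derive.
      auto_derive; [exact D|]. change (Derive (fun x0 => chi x0) y) with (Derive chi y). ring.
Qed.

Lemma exp_cutoff_bound_le A B r N chi : smooth chi -> (forall x, r < x -> chi x = 0) ->
  exists K, 0 <= K /\ forall s j x, 1 <= s -> (j <= N)%nat -> A <= x <= B ->
    Rabs (Derive_n (fun x => chi x * exp (s * x)) j x) <= K * s ^ N * exp (s * r).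
Proof.
  intros Hchi Hz. induction N as [|N [K [HK H]]].
  - destruct (exp_cutoff_bound A B r 0 chi Hchi Hz) as [K [HK H]]. exists K. split; [exact HK|].
    intros s j x Hs Hj Hx. replace j with 0%nat by lia. now apply H.
  - destruct (exp_cutoff_bound A B r (S N) chi Hchi Hz) as [K' [HK' H']].
    exists (K + K'). split; [lra|]. intros s j x Hs Hj Hx.
    assert (0 < s ^ N) as Hsj by (apply pow_lt; lra).
    assert (s ^ N <= s ^ S N) as Hss by (simpl; nra).
    assert (0 < exp (s * r)) as He by apply exp_pos.
    assert (K * s ^ N * exp (s * r) <= K * s ^ S N * exp (s * r)) as G1.
    { apply Rmult_le_compat_r; [lra|]. now apply Rmult_le_compat_l. }
    assert (0 <= K * s ^ N * exp (s * r)) as G2.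
    { apply Rmult_le_pos; [apply Rmult_le_pos; lra|lra]. }
    assert (0 <= K' * s ^ S N * exp (s * r)) as G3.
    { apply Rmult_le_pos; [apply Rmult_le_pos; lra|lra]. }
    rewrite !Rmult_plus_distr_r.
    destruct (Nat.eq_dec j (S N)) as [->|Hne].
    + generalize (H' s x Hs Hx). lra.
    + generalize (H s j x Hs ltac:(lia) Hx). lra.
Qed.

(** Order [N] costs a factor [s^N], which [exp (s del)] absorbs for every [del > 0]. *)
Lemma exp_cutoff_growth N A B r chi mu del : order_at_most N A B mu -> 0 < del ->
  smooth chi -> (forall x, r < x -> chi x = 0) ->
  exists K, 0 <= K /\ forall s, 1 <= s ->
    Rabs (mu (fun x => chi x * exp (s * x))) <= K * exp (s * (r + del)).
Proof.
  intros [C [HC Hb]] Hdel Hchi Hz.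
  destruct (exp_cutoff_bound_le A B r N chi Hchi Hz) as [K [HK H]].
  (* The constant in [s^(N+1) <= q exp (s del)], from [exp_ge_pow] at [s del]. *)
  set (q := (INR (S N) / del) ^ S N).
  assert (0 <= q) as Hq by (apply pow_le, Rdiv_le_0_compat; [apply pos_INR|exact Hdel]).
  exists (C * K * q). split; [apply Rmult_le_pos; [nra|exact Hq]|]. intros s Hs.
  apply Rle_trans with (C * (K * s ^ N * exp (s * r))).
  - apply Hb; [apply smooth_mult; [exact Hchi|apply smooth_exp_scal]|]. intros; now apply H.
  - assert (s ^ N <= q * exp (s * del)) as Hp.
    { apply Rle_trans with (s ^ S N); [simpl; assert (0 < s ^ N) by (apply pow_lt; lra); nra|].
      generalize (exp_ge_pow N (s * del) ltac:(nra)). rewrite Rpow_mult_distr. intros E.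
      assert (0 < del ^ S N) as Hd by now apply pow_lt.
      apply Rmult_le_reg_r with (1 := Hd). apply Rle_trans with (1 := E). right.
      unfold q, Rdiv. rewrite Rpow_mult_distr, pow_inv. field. lra. }
    rewrite Rmult_plus_distr_l, exp_plus.
    assert (0 < exp (s * r)) as He by apply exp_pos.
    replace (C * K * q * (exp (s * r) * exp (s * del))) with
      (C * (K * (q * exp (s * del)) * exp (s * r))) by ring.
    apply Rmult_le_compat_l; [exact HC|]. apply Rmult_le_compat_r; [lra|].
    now apply Rmult_le_compat_l.
Qed.

(** * Multiplicativity and growth *)

Lemma carried_ext A u phi psi : is_real_distr u -> carried A u -> test_fun phi -> test_fun psi ->
  (exists eps, 0 < eps /\ forall x y, A x -> Rabs (y - x) < eps -> phi y = psi y) ->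
  u phi = u psi.
Proof.
  intros Hu HA Hphi Hpsi [eps [He H]].
  enough (u (fun x => 1 * phi x + (-1) * psi x) = 0) as E.
  { rewrite (distr_lin u Hu) in E by assumption. lra. }
  apply HA; [apply test_fun_plus; now apply test_fun_scal|].
  exists eps. split; [exact He|]. intros x y Hx Hy. rewrite (H x y Hx Hy). ring.
Qed.

(** Made for the addition formulas: [t = -1] serves the cosine, [t = 1] the sine. The identity holds
    only near [A] and [B], so [carried_ext] is applied in each variable in turn. *)
Lemma rconv_split u w (A B : R -> Prop) E a1 b1 a2 b2 t : is_real_distr u -> is_real_distr w ->
  carried A u -> carried B w -> test_fun E ->
  test_fun a1 -> test_fun b1 -> test_fun a2 -> test_fun b2 ->
  (exists eps, 0 < eps /\ forall x x' y y', A x -> Rabs (x' - x) < eps -> B y ->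
     Rabs (y' - y) < eps -> E (x' + y') = a1 x' * b1 y' + t * (a2 x' * b2 y')) ->
  rconv u w E = u a1 * w b1 + t * (u a2 * w b2).
Proof.
  intros Hu Hw HA HB HE Ha1 Hb1 Ha2 Hb2 [eps [He H]]. unfold rconv.
  replace (u a1 * w b1 + t * (u a2 * w b2)) with (u (fun x => w b1 * a1 x + (t * w b2) * a2 x)).
  2: { rewrite (distr_lin u Hu) by assumption. ring. }
  apply (carried_ext A u _ _ Hu HA); [now apply test_fun_distr_shift| |].
  { apply test_fun_plus; now apply test_fun_scal. }
  exists eps. split; [exact He|]. intros x x' Hx Hx'.
  replace (w b1 * a1 x' + t * w b2 * a2 x') with (w (fun y => a1 x' * b1 y + (t * a2 x') * b2 y)).
  2: { rewrite (distr_lin w Hw) by assumption. ring. }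
  apply (carried_ext B w _ _ Hw HB); [now apply test_fun_shift| |].
  { apply test_fun_plus; now apply test_fun_scal. }
  exists eps. split; [exact He|]. intros y y' Hy Hy'.
  rewrite (H x x' y y') by assumption. ring.
Qed.

Definition character (c d : R -> R) : Prop :=
  test_fun c /\ test_fun d /\
  (forall x y, c (x + y) = c x * c y - d x * d y) /\
  (forall x y, d (x + y) = d x * c y + c x * d y).

(* Real and imaginary part of [<f, c + i d>] and its squared modulus. *)
Definition pair_re (f : distr) (c d : R -> R) : R := fst f c - snd f d.
Definition pair_im (f : distr) (c d : R -> R) : R := snd f c + fst f d.
Definition pair_sq (f : distr) (c d : R -> R) : R := pair_re f c d ^ 2 + pair_im f c d ^ 2.

Definition twist (c kap : R -> R) (s : R) : R -> R := fun x => c x * exp (s * kap x).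

Lemma test_fun_twist c kap s : test_fun c -> test_fun kap -> test_fun (twist c kap s).
Proof.
  intros Hc Hk. apply (test_fun_pullback kap Hk c (fun y => exp (s * y)) Hc), smooth_exp_scal.
Qed.

(** Near the carriers the twisted character of [x + y] is the product of those of [x] and [y], so
    the complex pairing factors; then [|z w|^2 = |z|^2 |w|^2]. *)
Lemma pair_sq_conv f g (A B : R -> Prop) c d k1 k2 k s : is_distr f -> is_distr g ->
  carried_pair A f -> carried_pair B g -> character c d ->
  test_fun k1 -> test_fun k2 -> test_fun k ->
  (exists eps, 0 < eps /\ forall x x' y y', A x -> Rabs (x' - x) < eps -> B y ->
     Rabs (y' - y) < eps -> k (x' + y') = k1 x' + k2 y') ->
  pair_sq (conv f g) (twist c k s) (twist d k s) =
  pair_sq f (twist c k1 s) (twist d k1 s) * pair_sq g (twist c k2 s) (twist d k2 s).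
Proof.
  intros [F1 F2] [G1 G2] [A1 A2] [B1 B2] (Hc & Hd & Ac & Ad) H1 H2 Hk [eps [He Hadd]].
  assert (forall u w, is_real_distr u -> is_real_distr w -> carried A u -> carried B w ->
    rconv u w (twist c k s) = u (twist c k1 s) * w (twist c k2 s)
                              + (-1) * (u (twist d k1 s) * w (twist d k2 s))) as Ec.
  { intros u w Hu Hw HA HB. apply (rconv_split u w A B); auto using test_fun_twist.
    exists eps. split; [exact He|]. intros x x' y y' Hx Hx' Hy Hy'. unfold twist.
    rewrite (Hadd x x' y y'), Ac, Rmult_plus_distr_l, exp_plus by assumption. ring. }
  assert (forall u w, is_real_distr u -> is_real_distr w -> carried A u -> carried B w ->
    rconv u w (twist d k s) = u (twist d k1 s) * w (twist c k2 s)
                              + 1 * (u (twist c k1 s) * w (twist d k2 s))) as Ed.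
  { intros u w Hu Hw HA HB. apply (rconv_split u w A B); auto using test_fun_twist.
    exists eps. split; [exact He|]. intros x x' y y' Hx Hx' Hy Hy'. unfold twist.
    rewrite (Hadd x x' y y'), Ad, Rmult_plus_distr_l, exp_plus by assumption. ring. }
  unfold pair_sq, pair_re, pair_im, conv. simpl fst. simpl snd.
  rewrite !Ec, !Ed by assumption. ring.
Qed.

(** Contraposition and [1 + Y <= (1 + Y)^p]: no p-th root of [Y] has to be formed. *)
Lemma root_bound p X Y Z : (1 <= p)%nat -> 0 <= X -> 0 <= Y -> 0 < Z -> X ^ p <= Y * Z ^ p ->
  X <= (1 + Y) * Z.
Proof.
  intros Hp HX HY HZ H. apply Rnot_lt_le. intros Hlt.
  assert (((1 + Y) * Z) ^ p <= X ^ p) as H1 by (apply pow_incr; nra).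
  rewrite Rpow_mult_distr in H1.
  assert (1 + Y <= (1 + Y) ^ p) as H2.
  { destruct p as [|p]; [lia|]. simpl. assert (1 <= (1 + Y) ^ p) by (apply pow_R1_Rle; lra). nra. }
  assert (0 < Z ^ p) by now apply pow_lt. nra.
Qed.

(** * One end of the interval: the right one for [sg = 1], the left one for [sg = -1] *)

Section OneSided.
Variables (n p : nat) (f : distr) (a b sg c K1 K2 : R).
Let P := 2 * PI / INR n.
Hypotheses (Hn : (1 <= n)%nat) (Hp : (1 <= p)%nat) (Hf : is_distr f) (Hab : a <= b).
Hypothesis Hcar : carried_pair (periodic_arc P a b) f.
Hypothesis Hlen : INR p * (b - a) < P.
Hypothesis HcarK : carried_pair (periodic_arc P K1 K2) (conv_pow f p).
Hypotheses (HK1 : INR p * a <= K1) (HK2 : K2 <= INR p * b).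
Hypotheses (Hsg : sg = 1 \/ sg = -1).
Hypothesis HKc : forall x, K1 <= x <= K2 -> sg * x <= INR p * c.

Let p_ge_1 : 1 <= INR p.
Proof. apply (le_INR 1). exact Hp. Qed.

(** Half of the slack in [p (b - a) < P] is shared among the [2 p] ends of [p] intervals: each may
    grow by [ee] on both sides and the total length stays below [P]. *)
Let ee := (P - INR p * (b - a)) / (4 * INR p).

Let ee_pos : 0 < ee.
Proof. unfold ee. apply Rdiv_lt_0_compat; lra. Qed.

Let coord (j : nat) := coordinate P (INR j * (a - ee)) (INR j * (b + ee)).

Let coord_exists j : (j <= p)%nat -> exists lam, coord j lam.
Proof.
  intros Hj. apply le_INR in Hj. generalize (pos_INR j). intros H0.
  apply coordinate_exists.
  - apply Rmult_le_compat_l; lra.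
  - assert (INR p * ee = (P - INR p * (b - a)) / 4) as E by (unfold ee; field; lra).
    assert (INR j * (b - a + 2 * ee) <= INR p * (b - a + 2 * ee)) as E2
      by (apply Rmult_le_compat_r; lra). lra.
Qed.

Let coord_test_fun j lam : coord j lam -> test_fun lam.
Proof. intros (H1 & H2 & _). now apply (test_fun_of_period n). Qed.

Let coord_test_fun_sg j lam : coord j lam -> test_fun (fun x => sg * lam x).
Proof. intros H. now apply test_fun_scal, (coord_test_fun j). Qed.

(** One integer [k] serves both [x] and the nearby [x'], since a coordinate of level [j >= 1] is the
    identity on a margin of at least [ee]. *)
Let near_arc_coord j lam al be x x' : (1 <= j)%nat -> coord j lam ->
  INR j * a <= al -> be <= INR j * b -> periodic_arc P al be x -> Rabs (x' - x) < ee ->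
  exists k : Z, al <= x + P * IZR k <= be /\ lam x' = x' + P * IZR k.
Proof.
  intros Hj Hl Hal Hbe [k Hk] Hx. exists k. split; [exact Hk|].
  apply (coordinate_mod _ _ _ _ _ _ Hl). apply (le_INR 1) in Hj. simpl in Hj.
  apply Rabs_def2 in Hx. nra.
Qed.

(** The coordinate changes with [j], so [lam] is quantified inside the induction; in the base case
    its choice is immaterial, because [lam] and [lam1] agree near the carrying arc. *)
Lemma pair_sq_conv_pow ch ch' lam1 s : character ch ch' -> coord 1 lam1 ->
  forall j, (1 <= j)%nat -> (j <= p)%nat -> forall lam, coord j lam ->
  pair_sq (conv_pow f j) (twist ch (fun x => sg * lam x) s) (twist ch' (fun x => sg * lam x) s) =
  pair_sq f (twist ch (fun x => sg * lam1 x) s) (twist ch' (fun x => sg * lam1 x) s) ^ j.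
Proof.
  intros Hch Hl1 j Hj. induction Hj as [|j Hj IH]; intros Hjp lam Hl.
  - rewrite pow_1. change (conv_pow f 1) with f.
    assert (forall c, test_fun c -> forall u, is_real_distr u -> carried (periodic_arc P a b) u ->
      u (twist c (fun x => sg * lam x) s) = u (twist c (fun x => sg * lam1 x) s)) as E.
    { intros c0 Hc0 u Hu HA. apply (carried_ext _ u _ _ Hu HA);
        [apply test_fun_twist; [exact Hc0|now apply (coord_test_fun_sg 1)]
        |apply test_fun_twist; [exact Hc0|now apply (coord_test_fun_sg 1)]|].
      exists ee. split; [exact ee_pos|]. intros x y Hx Hy. unfold twist. do 3 f_equal.
      destruct Hx as [k Hk]. apply Rabs_def2 in Hy.
      rewrite (coordinate_mod _ _ _ _ y k Hl), (coordinate_mod _ _ _ _ y k Hl1);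
        simpl INR; lra. }
    destruct Hch as (Hc & Hd & _). destruct Hf as [F1 F2]. destruct Hcar as [C1 C2].
    unfold pair_sq, pair_re, pair_im.
    now rewrite !(E ch Hc _ F1 C1), !(E ch Hc _ F2 C2), !(E ch' Hd _ F1 C1), !(E ch' Hd _ F2 C2).
  - rewrite conv_pow_S by exact Hj.
    destruct (coord_exists j ltac:(lia)) as [lamj Hlj].
    rewrite (pair_sq_conv f (conv_pow f j) (periodic_arc P a b)
      (periodic_arc P (INR j * a) (INR j * b)) ch ch' (fun x => sg * lam1 x) (fun x => sg * lamj x)).
    + rewrite (IH ltac:(lia) lamj Hlj). simpl. ring.
    + exact Hf.
    + now apply is_distr_conv_pow.
    + exact Hcar.
    + now apply carried_conv_pow.
    + exact Hch.
    + now apply (coord_test_fun_sg 1).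
    + now apply (coord_test_fun_sg j).
    + now apply (coord_test_fun_sg (S j)).
    + exists ee. split; [exact ee_pos|]. intros x x' y y' Hx Hx' Hy Hy'.
      rewrite <- Rmult_plus_distr_l. f_equal.
      destruct (near_arc_coord 1 lam1 a b x x') as [k [Hk ->]]; auto; try (simpl; lra).
      destruct (near_arc_coord j lamj (INR j * a) (INR j * b) y y') as [l [Hkl ->]]; auto; try lra.
      (* The integers that bring [x'] and [y'] into their intervals add up to the one for
         [x' + y']. *)
      rewrite (coordinate_mod _ _ _ _ (x' + y') (k + l) Hl); rewrite plus_IZR; [ring|].
      apply Rabs_def2 in Hx'. apply Rabs_def2 in Hy'. apply (le_INR 1) in Hj. simpl in Hj.
      rewrite S_INR. nra.
Qed.

(** Near the carrying arc [sg * lam] stays below [p c + del / 4], where [chi] is 1, so inserting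
    [chi] does not change the value. The cutoff ends at [p c + del / 2]; the other half of [del]
    pays for the order of the push-forward. *)
Lemma power_growth w lam ch del : is_real_distr w -> carried (periodic_arc P K1 K2) w ->
  coord p lam -> test_fun ch -> 0 < del ->
  exists K, 0 <= K /\ forall s, 1 <= s ->
    Rabs (w (twist ch (fun x => sg * lam x) s)) <= K * exp (s * (INR p * c + del)).
Proof.
  intros Hw Hcw Hl Hch Hdel.
  set (kap := fun x => sg * lam x).
  assert (test_fun kap) as Hkap by now apply (coord_test_fun_sg p).
  destruct (test_fun_bounded kap Hkap) as [B [HB0 HB]].
  destruct (order_pushforward kap B Hkap HB w ch Hw Hch) as [N HN].
  destruct (smooth_step (INR p * c + del / 4) (INR p * c + del / 2) ltac:(lra))
    as (chi & Hchi & _ & Hchi1 & Hchi0).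
  destruct (exp_cutoff_growth N (- B) B (INR p * c + del / 2) chi _ (del / 2) HN ltac:(lra) Hchi)
    as [K [HK H]].
  { intros x Hx. apply Hchi0. lra. }
  exists K. split; [exact HK|]. intros s Hs. specialize (H s Hs).
  replace (INR p * c + del / 2 + del / 2) with (INR p * c + del) in H by field.
  replace (w (twist ch kap s)) with (pushforward kap w ch (fun x => chi x * exp (s * x))); [exact H|].
  unfold pushforward. apply (carried_ext (periodic_arc P K1 K2) w _ _ Hw Hcw).
  - apply (test_fun_pullback kap Hkap ch (fun x => chi x * exp (s * x)) Hch).
    apply smooth_mult; [exact Hchi|apply smooth_exp_scal].
  - now apply test_fun_twist.
  - exists (Rmin ee (del / 4)). split; [apply Rmin_pos; lra|]. intros x y Hx Hy.
    assert (Rabs (y - x) < ee /\ Rabs (y - x) < del / 4) as [H1 H2].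
    { split; (eapply Rlt_le_trans; [exact Hy|]); [apply Rmin_l|apply Rmin_r]. }
    unfold twist. f_equal.
    destruct (near_arc_coord p lam K1 K2 x y Hp Hl HK1 HK2 Hx H1) as [k [Hk E]].
    rewrite Hchi1; [ring|]. unfold kap. rewrite E. generalize (HKc _ Hk).
    apply Rabs_def2 in H2. destruct Hsg as [->| ->]; lra.
Qed.

Lemma pair_growth lam1 ch ch' del : coord 1 lam1 -> character ch ch' -> 0 < del ->
  exists K, forall s, 1 <= s ->
    Rabs (pair_re f (twist ch (fun x => sg * lam1 x) s) (twist ch' (fun x => sg * lam1 x) s))
      <= K * exp (s * (c + del)) /\
    Rabs (pair_im f (twist ch (fun x => sg * lam1 x) s) (twist ch' (fun x => sg * lam1 x) s))
      <= K * exp (s * (c + del)).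
Proof.
  intros Hl1 Hch Hdel.
  destruct (coord_exists p (le_n p)) as [lam Hl].
  destruct (is_distr_conv_pow f p Hp Hf) as [G1 G2]. destruct HcarK as [C1 C2].
  assert (test_fun ch /\ test_fun ch') as [Hc Hd] by (destruct Hch as (? & ? & _); auto).
  (* The loss allowed for the p-fold power is [p del], so that the p-th root leaves [del]. *)
  assert (0 < INR p * del) as Hpd by nra.
  destruct (power_growth _ lam ch _ G1 C1 Hl Hc Hpd) as [k1 [Hk1 B1]].
  destruct (power_growth _ lam ch' _ G1 C1 Hl Hd Hpd) as [k2 [Hk2 B2]].
  destruct (power_growth _ lam ch _ G2 C2 Hl Hc Hpd) as [k3 [Hk3 B3]].
  destruct (power_growth _ lam ch' _ G2 C2 Hl Hd Hpd) as [k4 [Hk4 B4]].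
  (* The real part pairs [ch] with the first component and [ch'] with the second ([k1], [k4]), the
     imaginary part the other way round ([k3], [k2]). *)
  set (Y := (k1 + k4) ^ 2 + (k3 + k2) ^ 2).
  assert (0 <= Y) as HY by (apply Rplus_le_le_0_compat; apply pow2_ge_0).
  exists (1 + Y). intros s Hs.
  specialize (B1 s Hs). specialize (B2 s Hs). specialize (B3 s Hs). specialize (B4 s Hs).
  assert (pair_sq (conv_pow f p) (twist ch (fun x => sg * lam x) s) (twist ch' (fun x => sg * lam x) s)
    <= Y * (exp (s * (c + del)) ^ 2) ^ p) as HG.
  { replace ((exp (s * (c + del)) ^ 2) ^ p) with (exp (s * (INR p * c + INR p * del)) ^ 2).
    2: { rewrite !exp_pow_INR. f_equal. simpl. ring. }
    set (E := exp (s * (INR p * c + INR p * del))) in *.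
    unfold pair_sq, pair_re, pair_im, Y. rewrite Rmult_plus_distr_r, <- !Rpow_mult_distr.
    apply Rplus_le_compat; apply pow_maj_Rabs.
    - unfold Rminus. apply Rle_trans with (1 := Rabs_triang _ _). rewrite Rabs_Ropp. lra.
    - apply Rle_trans with (1 := Rabs_triang _ _). lra. }
  rewrite (pair_sq_conv_pow ch ch' lam1 s Hch Hl1 p Hp (le_n p) lam Hl) in HG.
  set (Z := exp (s * (c + del))) in *. assert (0 < Z) as HZ by apply exp_pos.
  assert (0 < Z ^ 2) as HZ2 by now apply pow_lt.
  apply root_bound in HG; [|exact Hp| |exact HY|exact HZ2].
  2: { apply Rplus_le_le_0_compat; apply pow2_ge_0. }
  unfold pair_sq in HG.
  set (x := pair_re _ _ _) in *. set (y := pair_im _ _ _) in *.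
  generalize (pow2_ge_0 x) (pow2_ge_0 y). intros Hx Hy.
  (* As [1 + Y >= 1], the sum of squares is below a square, which bounds each part separately. *)
  assert ((1 + Y) * Z ^ 2 <= ((1 + Y) * Z) ^ 2) as Hq by (rewrite Rpow_mult_distr; nra).
  assert (0 <= (1 + Y) * Z) as Hpos by nra.
  split; rewrite <- (Rabs_right ((1 + Y) * Z)) by lra; apply Rsqr_le_abs_0; unfold Rsqr; nra.
Qed.

(** Real and imaginary part are each a real functional of [Th] through the push-forward along
    [sg * lam1]. The growth rate [c + del / 2] leaves the strict gap to [c + del] that
    [vanish_of_exp_growth] requires. *)
Lemma pair_vanish lam1 ch ch' Th del : coord 1 lam1 -> character ch ch' -> 0 < del ->
  smooth Th -> (forall y, y <= c + del -> Th y = 0) ->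
  pair_re f (fun x => ch x * Th (sg * lam1 x)) (fun x => ch' x * Th (sg * lam1 x)) = 0 /\
  pair_im f (fun x => ch x * Th (sg * lam1 x)) (fun x => ch' x * Th (sg * lam1 x)) = 0.
Proof.
  intros Hl1 Hch Hdel HTh Hv.
  destruct (pair_growth lam1 ch ch' (del / 2) Hl1 Hch ltac:(lra)) as [K HK].
  assert (test_fun ch /\ test_fun ch') as [Hc Hd] by (destruct Hch as (? & ? & _); auto).
  set (kap := fun x => sg * lam1 x) in *.
  assert (test_fun kap) as Hkap by now apply (coord_test_fun_sg 1).
  destruct (test_fun_bounded kap Hkap) as [B [HB0 HB]].
  destruct Hf as [F1 F2].
  destruct (order_pushforward kap B Hkap HB _ ch F1 Hc) as [N1 O1].
  destruct (order_pushforward kap B Hkap HB _ ch' F1 Hd) as [N2 O2].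
  destruct (order_pushforward kap B Hkap HB _ ch F2 Hc) as [N3 O3].
  destruct (order_pushforward kap B Hkap HB _ ch' F2 Hd) as [N4 O4].
  split.
  - replace (pair_re f _ _) with
      (1 * pushforward kap (fst f) ch Th + (-1) * pushforward kap (snd f) ch' Th)
      by (unfold pair_re, pushforward, kap; ring).
    apply (vanish_of_exp_growth (N1 + N4) (fun g => 1 * pushforward kap (fst f) ch g +
      (-1) * pushforward kap (snd f) ch' g) (- B) B K (c + del / 2) (c + del)); auto; try lra.
    + apply linear_on_smooth_lin; now apply linear_pushforward.
    + now apply order_at_most_lin.
    + intros s Hs. destruct (HK s Hs) as [H1 _].
      replace (1 * pushforward kap (fst f) ch (fun t => exp (s * t)) +
        -1 * pushforward kap (snd f) ch' (fun t => exp (s * t))) with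
        (pair_re f (twist ch kap s) (twist ch' kap s))
        by (unfold pair_re, pushforward, twist; ring). exact H1.
  - replace (pair_im f _ _) with
      (1 * pushforward kap (snd f) ch Th + 1 * pushforward kap (fst f) ch' Th)
      by (unfold pair_im, pushforward, kap; ring).
    apply (vanish_of_exp_growth (N3 + N2) (fun g => 1 * pushforward kap (snd f) ch g +
      1 * pushforward kap (fst f) ch' g) (- B) B K (c + del / 2) (c + del)); auto; try lra.
    + apply linear_on_smooth_lin; now apply linear_pushforward.
    + now apply order_at_most_lin.
    + intros s Hs. destruct (HK s Hs) as [_ H1].
      replace (1 * pushforward kap (snd f) ch (fun t => exp (s * t)) +
        1 * pushforward kap (fst f) ch' (fun t => exp (s * t))) with
        (pair_im f (twist ch kap s) (twist ch' kap s))
        by (unfold pair_im, pushforward, twist; ring). exact H1.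
Qed.

Lemma character_conj ch ch' : character ch ch' -> character ch (fun x => (-1) * ch' x).
Proof.
  intros (H1 & H2 & H3 & H4). repeat split; try apply H1.
  - now apply smooth_scal, test_fun_smooth.
  - intros x. f_equal. apply H2.
  - intros. rewrite H3. ring.
  - intros. rewrite H4. ring.
Qed.

(* Using a character together with its conjugate separates the four real numbers
   that make up [pair_re] and [pair_im]. *)
Lemma twisted_vanish lam1 ch ch' Th del : coord 1 lam1 -> character ch ch' -> 0 < del ->
  smooth Th -> (forall y, y <= c + del -> Th y = 0) ->
  forall u, u = fst f \/ u = snd f ->
  u (fun x => ch x * Th (sg * lam1 x)) = 0 /\ u (fun x => ch' x * Th (sg * lam1 x)) = 0.
Proof.
  intros Hl1 Hch Hdel HTh Hv u Hu.
  destruct (pair_vanish lam1 ch ch' Th del Hl1 Hch Hdel HTh Hv) as [E1 E2].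
  destruct (pair_vanish lam1 _ _ Th del Hl1 (character_conj _ _ Hch) Hdel HTh Hv) as [E3 E4].
  assert (forall w, is_real_distr w -> w (fun x => -1 * ch' x * Th (sg * lam1 x)) =
    - w (fun x => ch' x * Th (sg * lam1 x))) as Hopp.
  { intros w Hw. replace (fun x => -1 * ch' x * Th (sg * lam1 x)) with
      (fun x => -1 * (ch' x * Th (sg * lam1 x))) by (apply functional_extensionality; intros; ring).
    rewrite (distr_scal w Hw); [ring|].
    apply (test_fun_pullback (fun x => sg * lam1 x) (coord_test_fun_sg 1%nat lam1 Hl1) ch' Th);
      [apply Hch|exact HTh]. }
  unfold pair_re, pair_im in *. rewrite Hopp in E3, E4 by apply Hf.
  destruct Hu as [->| ->]; lra.
Qed.

Variables (L1 L2 : R).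
Hypothesis HL : forall x, a <= x <= b -> sg * x <= c -> L1 <= x <= L2.
Hypothesis Hcab : a <= sg * c <= b.

(** [Th] has to become a function of the coordinate that vanishes up to slightly beyond [c]. As
    [sg * c] lies in [[L1, L2]], [Th] is zero around it and can be cut to zero below [c] without
    losing smoothness. Near the carrying arc the cut changes nothing, because [Th] is already zero
    on that side. *)
Lemma periodic_vanish ch ch' Th : character ch ch' -> smooth Th ->
  (forall x, Th (x + P) = Th x) -> vanishes_near (periodic_arc P L1 L2) Th ->
  forall u, u = fst f \/ u = snd f ->
  u (fun x => ch x * Th x) = 0 /\ u (fun x => ch' x * Th x) = 0.
Proof.
  intros Hch HTh Hper [eps [Heps Hv]] u Hu.
  assert (sg * sg = 1) as Hsq by (destruct Hsg as [->| ->]; ring).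
  assert (forall z, Rabs (sg * z) = Rabs z) as Hsabs.
  { intros z. destruct Hsg as [->| ->]; [f_equal; ring|].
    rewrite <- (Rabs_Ropp z). f_equal. ring. }
  assert (forall z, Rabs (z - sg * c) < eps -> Th z = 0) as Hvc.
  { intros z Hz. apply (Hv (sg * c)); [|exact Hz]. exists 0%Z.
    rewrite Rmult_0_r, Rplus_0_r. apply HL; [exact Hcab|nra]. }
  assert (forall y, Rabs (y - c) < eps -> Th (sg * y) = 0) as Hvc'.
  { intros y Hy. apply Hvc. now rewrite <- Rmult_minus_distr_l, Hsabs. }
  destruct (coord_exists 1 Hp) as [lam Hl].
  set (Tt := fun y => if Rle_dec y c then 0 else Th (sg * y)).
  assert (smooth Tt) as HTt.
  { apply (smooth_glue (fun _ => 0) (fun y => Th (sg * y)) c eps Heps); [apply smooth_const| |].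
    - apply (smooth_comp Th); [exact HTh|apply smooth_scal, smooth_id].
    - intros y Hy. symmetry. now apply Hvc'. }
  assert (forall y, y <= c + eps / 2 -> Tt y = 0) as HTt0.
  { intros y Hy. unfold Tt. destruct (Rle_dec y c) as [H|H]; [reflexivity|].
    apply Hvc'. apply Rabs_def1; lra. }
  assert (test_fun Th) as HThT by now apply (test_fun_of_period n).
  assert (is_real_distr u /\ carried (periodic_arc P a b) u) as [Hud Huc].
  { destruct Hu as [->| ->]; split; try apply Hf; apply Hcar. }
  assert (forall x x', periodic_arc P a b x -> Rabs (x' - x) < Rmin ee eps ->
    Th x' = Tt (sg * lam x')) as Hagree.
  { intros x x' Hx Hx'.
    assert (Rabs (x' - x) < ee /\ Rabs (x' - x) < eps) as [H1 H2].
    { split; (eapply Rlt_le_trans; [exact Hx'|]); [apply Rmin_l|apply Rmin_r]. }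
    destruct (near_arc_coord 1 lam a b x x') as [k [Hk ->]]; auto; try (simpl; lra).
    unfold Tt. destruct (Rle_dec (sg * (x' + P * IZR k)) c) as [H|H].
    - destruct (Rle_dec (sg * (x + P * IZR k)) c) as [H'|H'].
      + apply (Hv x); [|exact H2]. exists k. now apply HL.
      (* The translates of [x] and [x'] lie on different sides of [sg * c], so that of [x'] is
         within [eps] of it. *)
      + rewrite <- (periodic_IZR Th P k x' Hper). apply Hvc.
        apply Rabs_def2 in H2. apply Rabs_def1; destruct Hsg as [->| ->]; lra.
    - rewrite <- Rmult_assoc, Hsq, Rmult_1_l. now rewrite (periodic_IZR Th P k x' Hper). }
  destruct (twisted_vanish lam ch ch' Tt (eps / 2) Hl Hch ltac:(lra) HTt HTt0 u Hu) as [E1 E2].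
  destruct Hch as (Hc & Hd & _).
  assert (forall e, test_fun e -> u (fun x => e x * Th x) = u (fun x => e x * Tt (sg * lam x))) as E.
  { intros e He. apply (carried_ext _ u _ _ Hud Huc); [now apply test_fun_mult| |].
    - apply (test_fun_pullback (fun x => sg * lam x) (coord_test_fun_sg 1%nat lam Hl) e Tt He HTt).
    - exists (Rmin ee eps). split; [now apply Rmin_pos|]. intros x y Hx Hy.
      now rewrite (Hagree x y Hx Hy). }
  now rewrite !E.
Qed.
End OneSided.

(** * Separating the [n] rotations by characters *)

Lemma character_cos_sin m : character (fun x => cos (INR m * x)) (fun x => sin (INR m * x)).
Proof.
  assert (smooth (fun x => INR m * x)) as Hm by (apply smooth_scal, smooth_id).
  split; [|split; [|split]].
  - split; [apply (smooth_comp cos); [apply smooth_sin_cos|exact Hm]|].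
    intros x. rewrite Rmult_plus_distr_l, (Rmult_comm (INR m) (2 * PI)), INR_IZR_INZ.
    apply (periodic_IZR cos). intros y. rewrite cos_plus, cos_2PI, sin_2PI. ring.
  - split; [apply (smooth_comp sin); [apply smooth_sin_cos|exact Hm]|].
    intros x. rewrite Rmult_plus_distr_l, (Rmult_comm (INR m) (2 * PI)), INR_IZR_INZ.
    apply (periodic_IZR sin). intros y. rewrite sin_plus, cos_2PI, sin_2PI. ring.
  - intros x y. rewrite Rmult_plus_distr_l. apply cos_plus.
  - intros x y. rewrite Rmult_plus_distr_l, sin_plus. ring.
Qed.

(** Multiplied by [2 sin (th / 2)], which is nonzero as [0 < th / 2 < PI], the sum telescopes; the
    end terms cancel because [n th] is a multiple of [2 PI]. *)
Lemma sum_cos_roots n k : (0 < k < n)%nat ->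
  rsum (fun m => cos (INR m * (2 * PI / INR n * INR k))) n = 0.
Proof.
  intros Hk. set (th := 2 * PI / INR n * INR k).
  assert (0 < INR n) as Hn by (apply lt_0_INR; lia).
  assert (0 < INR k) as Hk0 by (apply lt_0_INR; lia).
  assert (INR k < INR n) as Hkn by (apply lt_INR; lia).
  assert (0 < th / 2 < PI) as Hth.
  { generalize PI_RGT_0. intros HPI. split.
    - apply Rdiv_lt_0_compat; [|lra]. apply Rmult_lt_0_compat; [apply Rdiv_lt_0_compat; lra|lra].
    - apply Rmult_lt_reg_r with (1 := Hn). unfold th.
      replace (2 * PI / INR n * INR k / 2 * INR n) with (PI * INR k) by (field; lra). nra. }
  assert (0 < sin (th / 2)) as Hs by (apply sin_gt_0; lra).
  assert (forall j, 2 * sin (th / 2) * rsum (fun m => cos (INR m * th)) j =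
    sin (INR j * th - th / 2) + sin (th / 2)) as Htel.
  { intros j. induction j as [|j IH].
    - simpl. replace (0 * th - th / 2) with (- (th / 2)) by ring. rewrite sin_neg. ring.
    - simpl rsum. rewrite Rmult_plus_distr_l, IH, S_INR.
      replace ((INR j + 1) * th - th / 2) with (INR j * th + th / 2) by field.
      rewrite sin_plus, sin_minus. ring. }
  specialize (Htel n).
  replace (INR n * th - th / 2) with (- (th / 2) + 2 * PI * IZR (Z.of_nat k)) in Htel.
  2: { rewrite <- INR_IZR_INZ. unfold th. field. lra. }
  rewrite (periodic_IZR sin), sin_neg in Htel.
  2: { intros y. rewrite sin_plus, cos_2PI, sin_2PI. ring. }
  nra.
Qed.

Lemma rsum_plus F G m : rsum (fun i => F i + G i) m = rsum F m + rsum G m.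
Proof. induction m as [|m IH]; simpl; [ring|]. rewrite IH. ring. Qed.

Lemma rsum_exchange (F : nat -> nat -> R) m k :
  rsum (fun i => rsum (fun j => F i j) k) m = rsum (fun j => rsum (fun i => F i j) m) k.
Proof.
  induction m as [|m IH]; simpl.
  - rewrite rsum_const. ring.
  - now rewrite IH, rsum_plus.
Qed.

Definition rot_sum (n : nat) (g : R -> R) (x : R) : R :=
  rsum (fun k => g (2 * PI / INR n * INR k + x)) n.

Lemma smooth_rot_sum n g : smooth g -> smooth (rot_sum n g).
Proof.
  intros Hg. apply (smooth_sum (fun k x => g (2 * PI / INR n * INR k + x))).
  intros; now apply smooth_shift.
Qed.

(** The shift exchanges the term at [x] for the one at [x + 2 PI]. *)
Lemma rot_sum_periodic n g x : (1 <= n)%nat -> (forall x, g (x + 2 * PI) = g x) ->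
  rot_sum n g (x + 2 * PI / INR n) = rot_sum n g x.
Proof.
  intros Hn Hg. assert (0 < INR n) as Hn0 by (apply lt_0_INR; lia). unfold rot_sum.
  set (P := 2 * PI / INR n).
  assert (forall j, rsum (fun k => g (P * INR k + (x + P))) j =
    rsum (fun k => g (P * INR k + x)) j + (g (x + P * INR j) - g x)) as H.
  { intros j. induction j as [|j IH].
    - simpl. replace (x + P * 0) with x by ring. ring.
    - simpl rsum. rewrite IH, S_INR.
      replace (P * INR j + x) with (x + P * INR j) by ring.
      replace (P * INR j + (x + P)) with (x + P * (INR j + 1)) by ring. ring. }
  rewrite H. replace (P * INR n) with (2 * PI) by (unfold P; field; lra). rewrite Hg. ring.
Qed.

Lemma vanishes_near_rot_sum n a b g : vanishes_near (periodic_arc (2 * PI / INR n) a b) g ->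
  vanishes_near (periodic_arc (2 * PI / INR n) a b) (rot_sum n g).
Proof.
  intros [eps [He Hv]]. exists eps. split; [exact He|]. intros x y Hx Hy. unfold rot_sum.
  rewrite <- (Rmult_0_r (INR n)), <- rsum_const. apply rsum_ext. intros k _.
  apply (Hv (x + 2 * PI / INR n * IZR (Z.of_nat k))).
  - now apply periodic_arc_shift.
  - rewrite <- INR_IZR_INZ.
    replace (2 * PI / INR n * INR k + y - (x + 2 * PI / INR n * INR k)) with (y - x) by ring.
    exact Hy.
Qed.

(* Discrete Fourier inversion over the rotations by multiples of [2 PI / n]. *)
Lemma rot_fourier n phi x : (1 <= n)%nat ->
  phi x = / INR n * rsum (fun m =>
    cos (INR m * x) * rot_sum n (fun y => cos (INR m * y) * phi y) x +
    sin (INR m * x) * rot_sum n (fun y => sin (INR m * y) * phi y) x) n.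
Proof.
  intros Hn. assert (0 < INR n) as Hn0 by (apply lt_0_INR; lia).
  apply Rmult_eq_reg_l with (INR n); [|lra].
  rewrite <- Rmult_assoc, Rinv_r, Rmult_1_l by lra. unfold rot_sum.
  set (P := 2 * PI / INR n).
  rewrite (rsum_ext _ (fun m => rsum (fun k => phi (P * INR k + x) * cos (INR m * (P * INR k))) n)).
  - rewrite rsum_exchange.
    rewrite (rsum_ext _ (fun k => phi (P * INR k + x) * rsum (fun m => cos (INR m * (P * INR k))) n))
      by (intros; apply rsum_scal).
    destruct n as [|n']; [lia|]. rewrite rsum_sum_f_R0.
    (* Only [k = 0] contributes: for [0 < k < n] the inner cosine sum is zero. *)
    assert (forall j, (j <= n')%nat -> sum_f_R0 (fun k => phi (P * INR k + x) *
      rsum (fun m => cos (INR m * (P * INR k))) (S n')) j = INR (S n') * phi x) as H.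
    { intros j Hj. induction j as [|j IH].
      - cbn [sum_f_R0]. change (INR 0) with 0. rewrite Rmult_0_r, Rplus_0_l.
        rewrite (rsum_ext _ (fun _ => 1)).
        + rewrite rsum_const. ring.
        + intros. now rewrite Rmult_0_r, cos_0.
      - rewrite tech5, IH by lia. unfold P. rewrite sum_cos_roots by lia. ring. }
    now rewrite H.
  - intros m _. rewrite <- !rsum_scal.
    rewrite <- rsum_plus. apply rsum_ext. intros k _.
    replace (INR m * (P * INR k)) with (INR m * (P * INR k + x) - INR m * x) by ring.
    rewrite cos_minus. ring.
Qed.

(** Fourier inversion writes [phi] as a sum of cosines and sines with [2 PI / n]-periodic
    coefficients; these inherit the vanishing near the arc, so [periodic_vanish] kills every
    term. *)
Theorem one_sided_support n p f a b sg c K1 K2 L1 L2 (P := 2 * PI / INR n) :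
  (1 <= n)%nat -> (1 <= p)%nat -> is_distr f -> a <= b ->
  carried_pair (periodic_arc P a b) f -> INR p * (b - a) < P ->
  carried_pair (periodic_arc P K1 K2) (conv_pow f p) ->
  INR p * a <= K1 -> K2 <= INR p * b -> sg = 1 \/ sg = -1 ->
  (forall x, K1 <= x <= K2 -> sg * x <= INR p * c) ->
  (forall x, a <= x <= b -> sg * x <= c -> L1 <= x <= L2) -> a <= sg * c <= b ->
  carried_pair (periodic_arc P L1 L2) f.
Proof.
  intros Hn Hp Hf Hab Hcar Hlen HcarK HK1 HK2 Hsg HKc HL Hcab.
  assert (forall u, u = fst f \/ u = snd f -> carried (periodic_arc P L1 L2) u) as H.
  2: split; apply H; auto.
  intros u Hu phi Hphi Hv.
  assert (is_real_distr u) as Hud by (destruct Hu as [->| ->]; apply Hf).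
  assert (forall e, test_fun e -> smooth (rot_sum n (fun y => e y * phi y)) /\
    (forall x, rot_sum n (fun y => e y * phi y) (x + P) = rot_sum n (fun y => e y * phi y) x) /\
    vanishes_near (periodic_arc P L1 L2) (rot_sum n (fun y => e y * phi y))) as Hrot.
  { intros e He. assert (test_fun (fun y => e y * phi y)) as Hep by now apply test_fun_mult.
    split; [|split].
    - now apply smooth_rot_sum, test_fun_smooth.
    - intros x. apply rot_sum_periodic; [exact Hn|]. apply Hep.
    - apply vanishes_near_rot_sum. destruct Hv as [eps [He0 Hv]]. exists eps. split; [exact He0|].
      intros x y Hx Hy. rewrite (Hv x y Hx Hy). ring. }
  assert (forall m, test_fun (fun x => cos (INR m * x)) /\ test_fun (fun x => sin (INR m * x))) as Hcs.
  { intros m. destruct (character_cos_sin m) as (? & ? & _). auto. }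
  set (F := fun m x =>
    cos (INR m * x) * rot_sum n (fun y => cos (INR m * y) * phi y) x +
    sin (INR m * x) * rot_sum n (fun y => sin (INR m * y) * phi y) x).
  assert (forall e, test_fun e -> test_fun (rot_sum n (fun y => e y * phi y))) as Hrt.
  { intros e He. destruct (Hrot e He) as (H1 & H2 & _). now apply (test_fun_of_period n). }
  assert (forall m, test_fun (F m)) as HF.
  { intros m. destruct (Hcs m) as [Hc Hs].
    apply test_fun_plus; apply test_fun_mult; auto. }
  replace phi with (fun x => / INR n * rsum (fun m => F m x) n).
  2: { apply functional_extensionality. intros x. symmetry. now apply rot_fourier. }
  rewrite (distr_scal u Hud) by now apply test_fun_rsum.
  rewrite (distr_rsum u Hud) by exact HF.
  rewrite (rsum_ext _ (fun _ => 0)); [rewrite rsum_const; ring|]. intros m _.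
  destruct (Hcs m) as [Hc Hs].
  unfold F. rewrite (distr_plus u Hud).
  - destruct (Hrot _ Hc) as (C1 & C2 & C3). destruct (Hrot _ Hs) as (D1 & D2 & D3).
    rewrite (proj1 (periodic_vanish n p f a b sg c K1 K2 Hn Hp Hf Hab Hcar Hlen HcarK HK1 HK2 Hsg HKc
      L1 L2 HL Hcab _ _ _ (character_cos_sin m) C1 C2 C3 u Hu)).
    rewrite (proj2 (periodic_vanish n p f a b sg c K1 K2 Hn Hp Hf Hab Hcar Hlen HcarK HK1 HK2 Hsg HKc
      L1 L2 HL Hcab _ _ _ (character_cos_sin m) D1 D2 D3 u Hu)). ring.
  - apply test_fun_mult; [exact Hc|apply (Hrt (fun y => cos (INR m * y)) Hc)].
  - apply test_fun_mult; [exact Hs|apply (Hrt (fun y => sin (INR m * y)) Hs)].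
Qed.

(** * Arcs *)

(** The integer that brings [a'] into [[a, b]] serves the whole interval: leaving [[a, b]] to the
    right means meeting the gap up to [a + 2 PI], which is nonempty because [b - a < 2 PI]. *)
Lemma arc_subset_lift a b a' b' : a' <= b' -> b - a < 2 * PI -> subset (arc a' b') (arc a b) ->
  exists m : Z, a <= a' + 2 * PI * IZR m /\ b' + 2 * PI * IZR m <= b.
Proof.
  intros Hab Hlen Hsub. assert (0 < PI) as HPI by apply PI_RGT_0.
  assert (forall x, a' <= x <= b' -> arc a b x) as H.
  { intros x Hx. apply Hsub. exists 0%Z. lra. }
  destruct (H a') as [m Hm]; [lra|]. exists m. split; [lra|].
  apply Rnot_lt_le. intros Hlt.
  (* a point of [[a', b']] landing in the gap between [b] and [a + 2 PI] *)
  set (y := Rmin (b' + 2 * PI * IZR m) ((b + (a + 2 * PI)) / 2)).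
  assert (y <= b' + 2 * PI * IZR m) as H1 by apply Rmin_l.
  assert (y <= (b + (a + 2 * PI)) / 2) as H2 by apply Rmin_r.
  assert (b < y) as H3 by (apply Rmin_glb_lt; lra).
  destruct (H (y - 2 * PI * IZR m)) as [k Hk]; [lra|].
  replace (y - 2 * PI * IZR m + 2 * PI * IZR k) with (y + 2 * PI * IZR (k - m)) in Hk
    by (rewrite minus_IZR; ring).
  destruct (Z_le_gt_dec 0 (k - m)) as [Hz|Hz].
  - apply IZR_le in Hz. nra.
  - assert (IZR (k - m) <= -1) by (apply (IZR_le _ (-1)); lia). nra.
Qed.

Lemma arc_shift a b m : set_eq (arc (a + 2 * PI * IZR m) (b + 2 * PI * IZR m)) (arc a b).
Proof.
  intros x. split; intros [k Hk].
  - exists (k - m)%Z. rewrite minus_IZR. lra.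
  - exists (k + m)%Z. rewrite plus_IZR. lra.
Qed.

(** An endpoint that is given up does not reappear through another translate, since
    [b - a < 2 PI]. *)
Lemma strict_subset_arc a b a' b' : b - a < 2 * PI -> a <= b -> a <= a' -> b' <= b ->
  a < a' \/ b' < b -> strict_subset (arc a' b') (arc a b).
Proof.
  intros Hlen Hab Ha Hb Hlt. split.
  - intros x [k Hk]. exists k. lra.
  - destruct Hlt as [Hlt|Hlt]; [exists a|exists b]; (split; [exists 0%Z; lra|]); intros [k Hk].
    + destruct (Z_le_gt_dec k 0) as [Hz|Hz].
      * apply IZR_le in Hz. generalize PI_RGT_0. nra.
      * assert (1 <= IZR k) by (apply IZR_le; lia). nra.
    + destruct (Z_le_gt_dec 0 k) as [Hz|Hz].
      * apply IZR_le in Hz. generalize PI_RGT_0. nra.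
      * assert (IZR k <= -1) by (apply (IZR_le _ (-1)); lia). nra.
Qed.

Theorem theorem3 (n p : nat) (f : distr) (a b : R) :
  (1 <= n)%nat -> (1 <= p)%nat -> is_distr f -> a <= b ->
  subset (supp f) (rot_union n (arc a b)) ->
  ~ (exists a' b' : R, a' <= b' /\ strict_subset (arc a' b') (arc a b) /\
                       subset (supp f) (rot_union n (arc a' b'))) ->
  b - a < 2 * PI / (INR p * INR n) ->
  subset (supp (conv_pow f p)) (rot_union n (arc (INR p * a) (INR p * b))) /\
  (forall a' b' : R, a' <= b' ->
     subset (arc a' b') (arc (INR p * a) (INR p * b)) ->
     subset (supp (conv_pow f p)) (rot_union n (arc a' b')) ->
     set_eq (arc a' b') (arc (INR p * a) (INR p * b))).
Proof.
  intros Hn Hp Hf Hab Hsupp Hmin Hlen.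
  assert (1 <= INR n) as Hn1 by (apply (le_INR 1); exact Hn).
  assert (1 <= INR p) as Hp1 by (apply (le_INR 1); exact Hp).
  assert (0 < PI) as HPI by apply PI_RGT_0.
  set (P := 2 * PI / INR n).
  assert (0 < P <= 2 * PI) as HP.
  { split; [apply Rdiv_lt_0_compat; lra|]. unfold P. apply Rmult_le_reg_r with (INR n); [lra|].
    replace (2 * PI / INR n * INR n) with (2 * PI) by (field; lra). nra. }
  assert (INR p * (b - a) < P) as HlenP.
  { apply Rmult_lt_compat_l with (r := INR p) in Hlen; [|lra].
    replace (INR p * (2 * PI / (INR p * INR n))) with P in Hlen by (unfold P; field; lra). exact Hlen. }
  assert (carried_pair (periodic_arc P a b) f) as Hcar.
  { apply supp_subset_carried; [exact Hf|]. intros x Hx. apply (rot_union_arc n a b Hn x), Hsupp, Hx. }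
  assert (is_distr (conv_pow f p)) as Hfp by now apply is_distr_conv_pow.
  split.
  - intros x Hx. apply (rot_union_arc n _ _ Hn x). revert x Hx.
    apply (carried_supp_subset n _ _ _ Hn). now apply carried_conv_pow.
  - intros a1 b1 Hab1 Hsub1 Hsupp1.
    (* [p (b - a) < P <= 2 PI] makes [p I] a proper arc, so the competing interval has
       representatives of its endpoints inside [[p a, p b]]. *)
    destruct (arc_subset_lift (INR p * a) (INR p * b) a1 b1 Hab1 ltac:(lra) Hsub1) as [m [Ha Hb]].
    set (a' := a1 + 2 * PI * IZR m) in *. set (b' := b1 + 2 * PI * IZR m) in *.
    assert (a' <= b') as Hab' by (unfold a', b'; lra).
    assert (carried_pair (periodic_arc P a' b') (conv_pow f p)) as HcarK.
    { apply supp_subset_carried; [exact Hfp|]. intros x Hx.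
      apply (rot_union_arc n a' b' Hn x). destruct (Hsupp1 x Hx) as [k [Hk Hk']].
      exists k. split; [exact Hk|]. now apply arc_shift. }
    (* Minimality of [I] in terms of carriers. *)
    assert (forall l r, a <= l -> l <= r -> r <= b -> a < l \/ r < b ->
      carried_pair (periodic_arc P l r) f -> False) as Hno.
    { intros l r Hl Hlr Hr Hlt Hc. apply Hmin. exists l, r. split; [exact Hlr|]. split.
      - apply strict_subset_arc; auto. nra.
      - intros x Hx. apply (rot_union_arc n l r Hn x). revert x Hx.
        now apply (carried_supp_subset n). }
    assert (INR p * (a' / INR p) = a') as Ea by (field; lra).
    assert (INR p * (b' / INR p) = b') as Eb by (field; lra).
    assert (a <= a' / INR p) as Ha'.
    { apply Rmult_le_reg_l with (INR p); lra. }
    assert (b' / INR p <= b) as Hb'.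
    { apply Rmult_le_reg_l with (INR p); lra. }
    assert (a' / INR p <= b' / INR p) as Hab''.
    { apply Rmult_le_reg_l with (INR p); lra. }
    assert (b' = INR p * b) as Eqb.
    { apply Rle_antisym; [exact Hb|]. apply Rnot_lt_le. intros Hlt.
      apply (Hno a (b' / INR p)); [lra|lra|exact Hb'|right; nra|].
      (* Right end: [c = b' / p], and [[a, b' / p]] is what remains of [[a, b]]. *)
      apply (one_sided_support n p f a b 1 (b' / INR p) a' b'); auto; try (intros; lra). }
    assert (a' = INR p * a) as Eqa.
    { apply Rle_antisym; [|exact Ha]. apply Rnot_lt_le. intros Hlt.
      apply (Hno (a' / INR p) b); [exact Ha'|lra|lra|left; nra|].
      (* Left end by reflection: [c = - (a' / p)], so that [sg * c = a' / p]. *)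
      apply (one_sided_support n p f a b (-1) (- (a' / INR p)) a' b'); auto; try (intros; lra). }
    rewrite <- Eqa, <- Eqb. intros x. symmetry. apply arc_shift.
Qed.
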